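(* Let $n\ge 1$ and $A\in\mathbb N_0^n$. There exists a smooth stable map $f:S^1\to S^1$ with $\mathrm{Ast}^{\#}(f)=[A]_E$ if and only if $A$ is feasible of type $(n,m)$ for some number $m$.
   Context: $\mathbb N_0=\{0,1,2,\dots\}$; $S^1$ is the unit circle in $\mathbb R^2$. $\Sigma(f)$ denotes the set of singular (critical) points of $f$. A smooth map $f:S^1\to S^1$ is stable in the usual ($C^\infty$) sense; equivalently, all its singular points are of Morse type (nondegenerate in local charts), $\Sigma(f)$ is finite, and $f|_{\Sigma(f)}$ is injective. Equivalence of tuples. For a set $X$ and $k\ge1$, two tuples $(t_1,\dots,t_k),(t'_1,\dots,t'_k)\in X^k$ are $E_k$-equivalent if there are $a\in\mathbb Z$ and a sign $\varepsilon\in\{1,-1\}$ such that $t_i=t'_{\varepsilon i+a}$ for all $i$, indices being read modulo $k$ in $\{1,\dots,k\}$. The class of $t$ is denoted $[t]_E$. Associated tuples. Let $P:[0,2\pi)\to S^1$, $P(t)=(\cos t,\sin t)$. Let $f:S^1\to S^1$ be stable with $\Sigma(f)\ne\emptyset$. Put $\Delta(f)=f(\Sigma(f))$, $n(f)=\#\Sigma(f)$, and $A(f)=P^{-1}(f^{-1}(\Delta(f)))=\{a_1<\dots<a_{N(f)}\}$. Let $T(a)=s$ if $P(a)\in\Sigma(f)$ and $T(a)=p$ otherwise, and let $\mathrm{Ast}(f)=(T(a_1),\dots,T(a_{N(f)}))\in\{s,p\}^{N(f)}$. Choose a representative $A'$ of $[\mathrm{Ast}(f)]_E$ whose last component is $s$;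 let $\rho(1)<\dots<\rho(n(f))$ be the positions of the symbol $s$ in $A'$, put $\rho(0)=0$ and $c_i=\rho(i)-\rho(i-1)-1$ for $i=1,\dots,n(f)$. Then $\mathrm{Ast}^{\#}(f)=[(c_1,\dots,c_{n(f)})]_E$, the $E_{n(f)}$-class in $\mathbb N_0^{n(f)}$; it does not depend on the choice of $A'$. ($\mathrm{Ast}^{\#}(f)$ is defined only for $f$ with $\Sigma(f)\neq\emptyset$.) Feasible tuples. A tuple $(x_1,\dots,x_n)\in\mathbb N_0^n$ is feasible of type $(n,m)$ if $n$ is even and: (1) $\sum_{i=1}^n x_i=m$; (2) $\sum_{i=1}^n(-1)^{i+1}x_i\equiv 0 \pmod n$; (3) $\{\sum_{i=1}^k(-1)^{i+1}(x_i+1) : k=1,\dots,n\}$ is a complete remainder system modulo $n$, i.e. it maps onto $\mathbb Z/n\mathbb Z$. *)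

(* Defs.v *)
From Stdlib Require Import Reals Lra ZArith List Sorted ClassicalEpsilon.
From Coquelicot Require Import Coquelicot.
Import ListNotations.
Open Scope R_scope.

Definition circle : Type := {q : R * R | fst q ^ 2 + snd q ^ 2 = 1}.

Lemma cos_sin_circle (t : R) : fst (cos t, sin t) ^ 2 + snd (cos t, sin t) ^ 2 = 1.
Proof. simpl; generalize (sin2_cos2 t); unfold Rsqr; lra. Qed.

(* P is defined on all of R; its restrictions to short intervals are the
   inverses of the angular charts of the circle. *)
Definition P (t : R) : circle := exist _ (cos t, sin t) (cos_sin_circle t).

(* g is a smooth expression of f in angular charts around P t and f (P t).
   Any two such g differ near t by a constant in 2 PI Z. *)
Definition chart_expr (f : circle -> circle) (t : R) (g : R -> R) : Prop :=
  locally t (fun s => f (P s) = P (g s) /\ forall k : nat, ex_derive_n g k s).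

Definition smooth (f : circle -> circle) : Prop :=
  forall t : R, exists g : R -> R, chart_expr f t g.

Definition singular (f : circle -> circle) (q : circle) : Prop :=
  exists (t : R) (g : R -> R), P t = q /\ chart_expr f t g /\ Derive g t = 0.

Definition morse (f : circle -> circle) (q : circle) : Prop :=
  exists (t : R) (g : R -> R),
    P t = q /\ chart_expr f t g /\ Derive g t = 0 /\ Derive_n g 2 t <> 0.

(* Stability of smooth maps between circles, in its standard form: Morse
   singularities, finitely many of them, with pairwise distinct values. *)
Definition stable (f : circle -> circle) : Prop :=
  (forall q, singular f q -> morse f q) /\
  (exists l : list circle, forall q, singular f q -> In q l) /\
  (forall q q', singular f q -> singular f q' -> f q = f q' -> q = q').

(* The component t_j of t = (t_1, ..., t_k), where j is read modulo k in
   {1, ..., k}. *)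
Definition component {X : Type} (t : list X) (j : Z) : option X :=
  nth_error t (Z.to_nat ((j - 1) mod Z.of_nat (length t))).

Definition E_equiv {X : Type} (t t' : list X) : Prop :=
  length t = length t' /\
  exists a eps : Z, (eps = 1 \/ eps = -1)%Z /\
    forall i : Z, (1 <= i <= Z.of_nat (length t))%Z ->
      component t i = component t' (eps * i + a).

Definition E_class {X : Type} (t : list X) : list X -> Prop :=
  fun t' => E_equiv t t'.

Inductive symbol : Type := sym_s | sym_p.

Definition Delta (f : circle -> circle) (y : circle) : Prop :=
  exists q, singular f q /\ f q = y.

Definition A_set (f : circle -> circle) (t : R) : Prop :=
  0 <= t < 2 * PI /\ Delta f (f (P t)).

Definition T (f : circle -> circle) (a : R) : symbol :=
  if excluded_middle_informative (singular f (P a)) then sym_s else sym_p.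

Definition is_Ast (f : circle -> circle) (w : list symbol) : Prop :=
  exists l : list R,
    StronglySorted Rlt l /\ (forall t, In t l <-> A_set f t) /\ w = map (T f) l.

Definition is_s (w : list symbol) (i : nat) : bool :=
  match nth_error w (i - 1) with Some sym_s => true | _ => false end.

(* The list (rho(0), rho(1), ..., rho(n)), positions being counted from 1. *)
Definition rho (w : list symbol) : list nat :=
  0%nat :: filter (is_s w) (seq 1 (length w)).

(* The natural subtractions are exact, since rho is strictly increasing. *)
Definition gaps (w : list symbol) : list nat :=
  map (fun i => nth i (rho w) 0 - nth (i - 1) (rho w) 0 - 1)%nat
      (seq 1 (length (rho w) - 1)).

(* The class is formed over all admissible representatives w'; it is empty
   when f has no singular point. *)
Definition Ast_sharp (f : circle -> circle) : list nat -> Prop :=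
  fun c => exists w w' : list symbol,
    is_Ast f w /\ E_class w w' /\ last w' sym_p = sym_s /\ E_class (gaps w') c.

Definition sumZ (k : nat) (u : nat -> Z) : Z :=
  fold_right Z.add 0%Z (map u (seq 1 k)).

Definition feasible (n m : nat) (x : list nat) : Prop :=
  let x_ i := Z.of_nat (nth (i - 1) x 0%nat) in
  let sgn i := ((-1) ^ Z.of_nat (i + 1))%Z in
  length x = n /\ Nat.Even n /\
  sumZ n x_ = Z.of_nat m /\
  (sumZ n (fun i => sgn i * x_ i) mod Z.of_nat n = 0)%Z /\
  forall r : Z, exists k : nat, (1 <= k <= n)%nat /\
    (sumZ k (fun i => sgn i * (x_ i + 1)) mod Z.of_nat n = r mod Z.of_nat n)%Z.

(* Main.v *)
From Stdlib Require Import Reals Lra Lia Psatz ZArith List Sorted Permutation.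
From Stdlib Require Import ClassicalEpsilon ProofIrrelevance.
From Stdlib Require Import FunctionalExtensionality PropExtensionality.
From Coquelicot Require Import Coquelicot.
Require Import Defs.
Import ListNotations.
Open Scope R_scope.

(** Why the theorem holds.

    Let [F : R -> R] be a lift of [f], of degree [D], and let [n] be the number of singular
    points. Call a parameter a hit when [f] sends it into [Delta f]. Number the hits on the line
    as [a j] and the angles of [Delta f] as [v k], both increasingly over [Z], and write
    [F (a j) = v (h j)]. Between consecutive hits [F] has no critical point and meets no [v k], so
    [h] changes by exactly one; by the Morse condition the direction of [h] is reversed at the
    singular hits, and it persists at the others. One turn of the source adds [n * D] to [h],
    because [v (k + n) = v k + 2 * PI]; and since [f] maps the singular points bijectively onto
    [Delta f], the heights of the singular hits represent every residue modulo [n].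

    All this is a property [balanced] of the cyclic word of [f] in the letters [s] and [p], in
    which [turn] is the direction and [height] the displacement of [h] along a word. A gap [x] is a
    run of [x] letters [p] closed by an [s], so after [k] gaps the displacement is the sum of the
    [(-1)^(i+1) * (x_i + 1)] with [i <= k]. Hence balance is feasibility: the direction is restored
    after one turn exactly when [n] is even, and then the ones cancel in the total displacement
    ([feasible_balanced]). This gives the necessity of the condition ([stable_word_balanced]).

    For the converse ([balanced_word_realized]) the [N] letters of a balanced word are put at the
    equidistant angles [2 * PI * j / N], the nodes, and [F] is built so that every edge between
    neighbouring nodes is mapped monotonically onto an arc of length [2 * PI / n]. Its derivative
    is a product of half-angle sines, which has the simple zeros and the sign changes demanded by
    the letters [s] and is [2 * PI]-periodic since their number is even, times a positive
    periodic weight containing one adjustable bump per edge, by which the integral over that edge is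
    corrected ([derivative_with_turns]). Balance says that [F] descends to the circle and that
    the singular values are distinct and exhaust the multiples of [2 * PI / n], so that the hits
    are exactly the nodes.

    Both directions use that a word ending in [s] and its gaps determine each other, in a way
    compatible with rotations and reversals ([E_equiv_word]). *)

(** * Rotations and reversals of lists *)

(** The orientation-preserving half of [E_equiv]. Quantifying over all integers rather than over one
    period turns symmetry and transitivity into arithmetic on the offset. *)
Definition rot_equiv {X : Type} (t t' : list X) : Prop :=
  length t = length t' /\
  exists a : Z, forall i : Z, component t i = component t' (i + a).

Lemma component_add_length {X : Type} (t : list X) (i k : Z) :
  component t (i + k * Z.of_nat (length t)) = component t i.
Proof.
  unfold component. f_equal. f_equal.
  destruct t as [|x t].
  - simpl. f_equal. ring.
  - rewrite <- (Z_mod_plus_full (i - 1) k). f_equal. ring.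
Qed.

Lemma component_nth {X : Type} (t : list X) (j : nat) :
  (j < length t)%nat -> component t (Z.of_nat j + 1) = nth_error t j.
Proof.
  intros H. unfold component. f_equal.
  rewrite Z.mod_small by lia. lia.
Qed.

Lemma component_shift_range {X : Type} (t t' : list X) (eps a : Z) :
  length t = length t' ->
  (forall i : Z, (1 <= i <= Z.of_nat (length t))%Z ->
     component t i = component t' (eps * i + a)) ->
  forall i : Z, component t i = component t' (eps * i + a).
Proof.
  intros Hl H i.
  destruct (Nat.eq_dec (length t) 0) as [H0|H0].
  - destruct t; [|discriminate]. destruct t'; [|discriminate].
    unfold component. simpl.
    destruct (Z.to_nat _), (Z.to_nat _); reflexivity.
  - pose proof (Z.div_mod (i - 1) (Z.of_nat (length t)) ltac:(lia)) as Hd.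
    pose proof (Z.mod_pos_bound (i - 1) (Z.of_nat (length t)) ltac:(lia)) as Hb.
    set (q := ((i - 1) / Z.of_nat (length t))%Z) in *.
    set (r := ((i - 1) mod Z.of_nat (length t))%Z) in *.
    replace i with ((r + 1) + q * Z.of_nat (length t))%Z at 1 by lia.
    rewrite component_add_length, H by lia.
    replace (eps * i + a)%Z
      with ((eps * (r + 1) + a) + (eps * q) * Z.of_nat (length t'))%Z
      by (rewrite <- Hl; nia).
    now rewrite component_add_length.
Qed.

Lemma rot_equiv_refl {X : Type} (t : list X) : rot_equiv t t.
Proof.
  split; [reflexivity|]. exists 0%Z. intros i. f_equal. lia.
Qed.

Lemma rot_equiv_sym {X : Type} (t t' : list X) :
  rot_equiv t t' -> rot_equiv t' t.
Proof.
  intros [Hl [a H]]. split; [easy|]. exists (- a)%Z. intros i.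
  rewrite H. f_equal. lia.
Qed.

Lemma rot_equiv_trans {X : Type} (t t' t'' : list X) :
  rot_equiv t t' -> rot_equiv t' t'' -> rot_equiv t t''.
Proof.
  intros [Hl [a H]] [Hl' [a' H']]. split; [congruence|].
  exists (a + a')%Z. intros i. rewrite H, H'. f_equal. lia.
Qed.

Lemma component_rev {X : Type} (t : list X) (i : Z) :
  component (rev t) i = component t (1 - i).
Proof.
  destruct (Nat.eq_dec (length t) 0) as [H0|H0].
  - destruct t; [|discriminate]. unfold component. simpl.
    destruct (Z.to_nat _), (Z.to_nat _); reflexivity.
  - unfold component. rewrite length_rev.
    set (N := Z.of_nat (length t)).
    pose proof (Z.mod_pos_bound (i - 1) N ltac:(lia)) as Hb.
    pose proof (Z.div_mod (i - 1) N ltac:(lia)) as Hd.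
    rewrite nth_error_rev.
    destruct (Nat.ltb_spec (Z.to_nat ((i - 1) mod N)) (length t)) as [_|Hn];
      [|lia].
    f_equal.
    set (q := ((i - 1) / N)%Z) in *. set (r := ((i - 1) mod N)%Z) in *.
    replace (1 - i - 1)%Z with ((N - 1 - r) + (- q - 1) * N)%Z
      by (replace i with (N * q + r + 1)%Z by lia; ring).
    rewrite Z_mod_plus_full, Z.mod_small by lia. lia.
Qed.

Lemma rot_equiv_rev {X : Type} (t t' : list X) :
  rot_equiv t t' -> rot_equiv (rev t) (rev t').
Proof.
  intros [Hl [a H]]. split; [now rewrite !length_rev|].
  exists (- a)%Z. intros i. rewrite !component_rev, H. f_equal. lia.
Qed.

(** A negative sign in [E_equiv] is a reversal followed by a rotation. *)
Lemma E_equiv_rot {X : Type} (t t' : list X) :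
  E_equiv t t' <-> rot_equiv t t' \/ rot_equiv t (rev t').
Proof.
  split.
  - intros [Hl [a [eps [He H]]]].
    pose proof (component_shift_range t t' eps a Hl H) as H'.
    destruct He as [-> | ->].
    + left. split; [easy|]. exists a. intros i. rewrite H'. f_equal. lia.
    + right. split; [now rewrite length_rev|]. exists (1 - a)%Z. intros i.
      rewrite H', component_rev. f_equal. lia.
  - intros [[Hl [a H]] | [Hl [a H]]].
    + split; [easy|]. exists a, 1%Z. split; [now left|]. intros i _.
      rewrite H. f_equal. lia.
    + rewrite length_rev in Hl. split; [easy|]. exists (1 - a)%Z, (-1)%Z.
      split; [now right|]. intros i _. rewrite H, component_rev. f_equal. lia.
Qed.

Lemma E_equiv_refl {X : Type} (t : list X) : E_equiv t t.
Proof. apply E_equiv_rot. left. apply rot_equiv_refl. Qed.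

Lemma E_equiv_trans {X : Type} (t t' t'' : list X) :
  E_equiv t t' -> E_equiv t' t'' -> E_equiv t t''.
Proof.
  rewrite (E_equiv_rot t t'), (E_equiv_rot t' t''), (E_equiv_rot t t'').
  intros [H|H] [H'|H'].
  - left. eapply rot_equiv_trans; eauto.
  - right. eapply rot_equiv_trans; eauto.
  - right. apply rot_equiv_rev in H'. eapply rot_equiv_trans; eauto.
  - left. apply rot_equiv_rev in H'. rewrite rev_involutive in H'.
    eapply rot_equiv_trans; eauto.
Qed.

Lemma component_swap {X : Type} (u v : list X) (i : Z) :
  component (u ++ v) i = component (v ++ u) (i + Z.of_nat (length v)).
Proof.
  rewrite <- (Z.mul_1_l i) at 2. revert i.
  apply component_shift_range; [rewrite !length_app; lia|].
  rewrite length_app. intros i Hi.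
  replace i with (Z.of_nat (Z.to_nat (i - 1)) + 1)%Z at 1 by lia.
  rewrite component_nth by (rewrite length_app; lia).
  destruct (Nat.lt_ge_cases (Z.to_nat (i - 1)) (length u)) as [Hlt|Hge].
  - rewrite nth_error_app1 by easy.
    replace (1 * i + Z.of_nat (length v))%Z
      with (Z.of_nat (length v + Z.to_nat (i - 1)) + 1)%Z by lia.
    rewrite component_nth by (rewrite length_app; lia).
    rewrite nth_error_app2 by lia. f_equal. lia.
  - rewrite nth_error_app2 by easy.
    replace (1 * i + Z.of_nat (length v))%Z
      with ((Z.of_nat (Z.to_nat (i - 1) - length u) + 1)
            + 1 * Z.of_nat (length (v ++ u)))%Z
      by (rewrite length_app; lia).
    rewrite component_add_length.
    rewrite component_nth by (rewrite length_app; lia).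
    rewrite nth_error_app1 by lia. reflexivity.
Qed.

Lemma rot_equiv_swap {X : Type} (u v : list X) :
  rot_equiv (u ++ v) (v ++ u).
Proof.
  split; [rewrite !length_app; lia|].
  exists (Z.of_nat (length v)). intros i. apply component_swap.
Qed.

Lemma component_ext {X : Type} (t t' : list X) :
  length t = length t' -> (forall i, component t i = component t' i) -> t = t'.
Proof.
  intros Hl H. apply nth_error_ext. intros j.
  destruct (Nat.lt_ge_cases j (length t)) as [Hj|Hj].
  - rewrite <- !component_nth by lia. apply H.
  - rewrite (proj2 (nth_error_None t j)) by easy.
    symmetry. apply nth_error_None. lia.
Qed.

(** Every offset is a cut: moving the part before the cut to the end is the only thing a rotation can
    do. It reduces statements on classes to identities about concatenations. *)
Lemma rot_equiv_swap_inv {X : Type} (t t' : list X) :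
  rot_equiv t t' -> exists u v, t = u ++ v /\ t' = v ++ u.
Proof.
  intros [Hl [a H]].
  destruct (Nat.eq_dec (length t) 0) as [H0|H0].
  { destruct t; [|discriminate]. destruct t'; [|discriminate].
    exists [], []. easy. }
  pose proof (Z.mod_pos_bound (- a) (Z.of_nat (length t)) ltac:(lia)) as Hb.
  pose proof (Z.div_mod (- a) (Z.of_nat (length t)) ltac:(lia)) as Hd.
  set (k := Z.to_nat ((- a) mod Z.of_nat (length t))).
  exists (firstn k t), (skipn k t).
  split; [now rewrite firstn_skipn|].
  assert (Hk : (k <= length t)%nat) by lia.
  assert (Hs : length (skipn k t ++ firstn k t) = length t).
  { rewrite length_app, length_skipn, length_firstn. lia. }
  apply component_ext; [congruence|]. intros i.
  replace i with ((i - a) + a)%Z at 1 by lia. rewrite <- H.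
  rewrite <- (firstn_skipn k t) at 1. rewrite component_swap, length_skipn.
  set (q := ((- a) / Z.of_nat (length t))%Z) in *.
  replace (i - a + Z.of_nat (length t - k))%Z
    with (i + (q + 1) * Z.of_nat (length (skipn k t ++ firstn k t)))%Z
    by (rewrite Hs; subst k; lia).
  apply component_add_length.
Qed.

(** * Words in the symbols [s] and [p], and their gaps *)

Definition word (A : list nat) : list symbol :=
  flat_map (fun x => repeat sym_p x ++ [sym_s]) A.

Lemma word_app (A B : list nat) : word (A ++ B) = word A ++ word B.
Proof. apply flat_map_app. Qed.

Lemma firstn_succ_nth {X : Type} (l : list X) (k : nat) (d : X) :
  (k < length l)%nat -> firstn (S k) l = firstn k l ++ [nth k l d].
Proof.
  revert l. induction k as [|k IH]; intros [|x l] Hk; simpl in Hk; try lia.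
  - easy.
  - cbn [firstn app nth]. f_equal. apply IH. lia.
Qed.

Lemma last_app_nonempty {X : Type} (u v : list X) (d : X) :
  v <> [] -> last (u ++ v) d = last v d.
Proof.
  intros Hv. destruct (exists_last Hv) as [v' [x ->]].
  now rewrite app_assoc, !last_last.
Qed.

Lemma last_word (A : list nat) : A <> [] -> last (word A) sym_p = sym_s.
Proof.
  intros HA. destruct (exists_last HA) as [B [x ->]].
  rewrite word_app. simpl. now rewrite app_nil_r, app_assoc, last_last.
Qed.

Lemma word_of_last (w : list symbol) :
  w = [] \/ last w sym_p = sym_s -> exists A, w = word A.
Proof.
  induction w as [|x w IH]; intros H.
  - now exists [].
  - destruct H as [H|H]; [discriminate|].
    destruct w as [|y w].
    + simpl in H. subst x. now exists [0%nat].
    + destruct IH as [A HA]; [right; exact H|].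
      destruct x.
      * exists (0%nat :: A). simpl. now rewrite HA.
      * destruct A as [|a A]; [discriminate|].
        exists (S a :: A). now rewrite HA.
Qed.

Lemma word_prefix (A : list nat) (u v : list symbol) :
  word A = u ++ v -> v = [] \/ last v sym_p = sym_s.
Proof.
  intros H. destruct v as [|x v]; [now left|right].
  rewrite <- (last_app_nonempty u) by discriminate. rewrite <- H.
  apply last_word. intros ->. now destruct u.
Qed.

Fixpoint marks (k : nat) (w : list symbol) : list nat :=
  match w with
  | [] => []
  | sym_s :: w' => k :: marks (S k) w'
  | sym_p :: w' => marks (S k) w'
  end.

Lemma rho_marks (w : list symbol) : rho w = 0%nat :: marks 1 w.
Proof.
  unfold rho. f_equal.
  enough (G : forall v u, u ++ v = w ->
    filter (is_s w) (seq (S (length u)) (length v)) = marks (S (length u)) v)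
    by (now apply (G w [])).
  induction v as [|x v IH]; intros u Hw; [reflexivity|].
  assert (Hx : is_s w (S (length u)) = match x with sym_s => true | _ => false end).
  { unfold is_s. rewrite <- Hw. simpl. rewrite Nat.sub_0_r.
    rewrite nth_error_app2, Nat.sub_diag by lia. now destruct x. }
  specialize (IH (u ++ [x])). rewrite length_app in IH. simpl in IH.
  rewrite <- app_assoc, Nat.add_1_r in IH. specialize (IH Hw).
  simpl seq. simpl filter. rewrite Hx. destruct x; simpl; now rewrite IH.
Qed.

Lemma marks_repeat_p (x k : nat) (w : list symbol) :
  marks k (repeat sym_p x ++ w) = marks (k + x) w.
Proof.
  revert k. induction x as [|x IH]; intros k; simpl.
  - f_equal. lia.
  - rewrite IH. f_equal. lia.
Qed.

Lemma gaps_word (A : list nat) : gaps (word A) = A.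
Proof.
  unfold gaps. rewrite rho_marks.
  enough (G : forall k,
    map (fun i => nth i (k :: marks (S k) (word A)) 0
           - nth (i - 1) (k :: marks (S k) (word A)) 0 - 1)%nat
      (seq 1 (length (k :: marks (S k) (word A)) - 1)) = A) by apply G.
  induction A as [|x A IH]; intros k; [reflexivity|].
  simpl word. rewrite <- app_assoc, marks_repeat_p.
  simpl marks. simpl length. simpl seq. simpl map.
  f_equal; [destruct k; lia|].
  etransitivity; [|apply (IH (S (k + x)))]. cbn [length]. rewrite Nat.sub_succ, Nat.sub_0_r.
  rewrite <- seq_shift, map_map. apply map_ext_in.
  intros [|i] Hi; [apply in_seq in Hi; lia|]. simpl. now rewrite Nat.sub_0_r.
Qed.

Lemma word_gaps (w : list symbol) :
  last w sym_p = sym_s -> w = word (gaps w).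
Proof.
  intros H. destruct (word_of_last w (or_intror H)) as [A ->].
  now rewrite gaps_word.
Qed.

(** Reversing a word moves each separator [s] from the end of its block to the front; one more
    [s] on either side restores the block structure. *)
Lemma rev_word (A : list nat) : rev (word A) ++ [sym_s] = sym_s :: word (rev A).
Proof.
  induction A as [|x A IH]; [reflexivity|].
  simpl. rewrite word_app, !rev_app_distr. simpl.
  rewrite app_comm_cons, <- IH, <- !app_assoc. simpl. now rewrite rev_repeat.
Qed.

Lemma rot_equiv_rev_word (A : list nat) :
  rot_equiv (rev (word A)) (word (rev A)).
Proof.
  destruct (word A) as [|x w] eqn:E.
  - destruct A as [|a A]; [apply rot_equiv_refl|].
    destruct a; discriminate.
  - pose proof (rev_word A) as H. rewrite E in H.
    destruct (rev (x :: w)) as [|y r].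
    + injection H as <-. apply rot_equiv_refl.
    + injection H as -> H. rewrite <- H. apply (rot_equiv_swap [sym_s] r).
Qed.

(** A rotation between two words that end in [s] cuts both of them at the end of a block, so it
    comes from a rotation of the gaps. *)
Lemma rot_equiv_word (A B : list nat) :
  rot_equiv (word A) (word B) <-> rot_equiv A B.
Proof.
  split; intros H; apply rot_equiv_swap_inv in H; destruct H as [u [v [H H']]].
  - destruct (word_of_last v (word_prefix _ _ _ H)) as [B1 ->].
    destruct (word_of_last u (word_prefix _ _ _ H')) as [A1 ->].
    rewrite <- word_app in H, H'. apply (f_equal gaps) in H, H'.
    rewrite !gaps_word in H, H'. subst. apply rot_equiv_swap.
  - subst. rewrite !word_app. apply rot_equiv_swap.
Qed.

Lemma E_equiv_word (A B : list nat) :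
  E_equiv (word A) (word B) <-> E_equiv A B.
Proof.
  rewrite (E_equiv_rot A B), (E_equiv_rot (word A)).
  rewrite <- !rot_equiv_word.
  pose proof (rot_equiv_rev_word B) as HB.
  split; (intros [H|H]; [now left|right]).
  - eapply rot_equiv_trans; eauto.
  - eapply rot_equiv_trans; [eauto|]. now apply rot_equiv_sym.
Qed.

(** * Heights *)

Definition flip (x : symbol) : Z :=
  match x with sym_s => (-1)%Z | sym_p => 1%Z end.

(** A walk on the integers starts at zero in the positive direction, makes one unit step before each
    letter, and reverses its direction at each [s]. [turn] is the final direction and [height] the
    final position. *)
Fixpoint turn (w : list symbol) : Z :=
  match w with [] => 1%Z | x :: w' => (flip x * turn w')%Z end.

Fixpoint height (w : list symbol) : Z :=
  match w with [] => 0%Z | x :: w' => (1 + flip x * height w')%Z end.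

Definition count_s (w : list symbol) : nat :=
  length (filter (fun x => match x with sym_s => true | _ => false end) w).

(** The conditions under which the walk of a cyclic word lives on a circle with as many marked values
    as singular letters: it closes up with its direction, and the singular letters meet every value. *)
Definition balanced (w : list symbol) : Prop :=
  turn w = 1%Z /\
  (Z.of_nat (count_s w) | height w)%Z /\
  forall r : Z, exists u v, w = u ++ sym_s :: v /\
    (Z.of_nat (count_s w) | height (u ++ [sym_s]) - r)%Z.

Lemma turn_app (u v : list symbol) : turn (u ++ v) = (turn u * turn v)%Z.
Proof. induction u as [|x u IH]; cbn [turn height app]; [ring|]. rewrite IH. ring. Qed.

Lemma height_app (u v : list symbol) :
  height (u ++ v) = (height u + turn u * height v)%Z.
Proof. induction u as [|x u IH]; cbn [turn height app]; [ring|]. rewrite IH. ring. Qed.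

Lemma count_s_app (u v : list symbol) :
  count_s (u ++ v) = (count_s u + count_s v)%nat.
Proof. unfold count_s. now rewrite filter_app, length_app. Qed.

Lemma turn_unit (w : list symbol) : turn w = 1%Z \/ turn w = (-1)%Z.
Proof. induction w as [|[] w IH]; cbn [turn flip]; lia. Qed.

Lemma turn_rev (w : list symbol) : turn (rev w) = turn w.
Proof.
  induction w as [|x w IH]; cbn [turn rev]; [easy|].
  rewrite turn_app, IH. cbn [turn]. ring.
Qed.

(** The reversed walk runs through the same edges, but it makes its steps after the letters instead of
    before them. *)
Lemma height_rev (w : list symbol) :
  height (rev w) = (turn w * (height w + turn w - 1))%Z.
Proof.
  induction w as [|x w IH]; cbn [turn height rev]; [easy|].
  rewrite height_app, IH, turn_rev. cbn [height].
  destruct x, (turn_unit w) as [-> | ->]; simpl flip; ring.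
Qed.

(** Cutting the cyclic word elsewhere changes the origin of the walk and possibly its orientation;
    closing up makes this harmless modulo the number of singular letters. *)
Lemma balanced_swap (u v : list symbol) : balanced (u ++ v) -> balanced (v ++ u).
Proof.
  unfold balanced. rewrite !count_s_app, (Nat.add_comm (count_s v)).
  set (n := Z.of_nat _). intros [Ht [Hh Hc]].
  rewrite turn_app in Ht. rewrite height_app in Hh.
  assert (Huv : ((turn u = 1 /\ turn v = 1) \/ (turn u = -1 /\ turn v = -1))%Z).
  { pose proof (turn_unit u). pose proof (turn_unit v). nia. }
  split; [rewrite turn_app; lia|]. split.
  - rewrite height_app. destruct Hh as [q Hq].
    exists (turn u * q)%Z. destruct Huv as [[Eu Ev]|[Eu Ev]]; rewrite Eu, Ev in *; lia.
  - intros r. destruct Hh as [q Hq].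
    destruct (Hc (turn u * r + height u)%Z) as [a [b [Hab Hr]]].
    destruct Hr as [q' Hq'].
    assert (Hcase : (exists b', u = a ++ sym_s :: b' /\ b = b' ++ v) \/
                    (exists a', a = u ++ a' /\ v = a' ++ sym_s :: b)).
    { clear - Hab. revert a Hab. induction u as [|x u IH]; intros a Hab.
      - right. now exists a.
      - destruct a as [|y a]; simpl in Hab; injection Hab as -> Hab.
        + left. exists u. now split.
        + destruct (IH a Hab) as [[b' [-> ->]]|[a' [-> ->]]].
          * left. now exists b'.
          * right. now exists a'. }
    destruct Hcase as [[b' [Hu Hb]]|[a' [Ha Hv]]].
    + exists (v ++ a), b'. split; [now rewrite Hu, app_assoc|].
      rewrite <- app_assoc, height_app.
      destruct Huv as [[Eu Ev]|[Eu Ev]]; rewrite Eu, Ev in *.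
      * exists (q + q')%Z. lia.
      * exists (- q - q')%Z. lia.
    + exists a', (b ++ u). split; [now rewrite Hv, <- app_assoc|].
      rewrite Ha, <- app_assoc, height_app in Hq'.
      destruct Huv as [[Eu Ev]|[Eu Ev]]; rewrite Eu, Ev in *.
      * exists q'. lia.
      * exists (- q')%Z. lia.
Qed.

Lemma balanced_rev (w : list symbol) : balanced w -> balanced (rev w).
Proof.
  unfold balanced.
  assert (Hn : count_s (rev w) = count_s w).
  { unfold count_s. now rewrite filter_rev, length_rev. }
  rewrite Hn. set (n := Z.of_nat _). intros [Ht [Hh Hc]].
  split; [now rewrite turn_rev|]. split.
  - rewrite height_rev, Ht. now replace (1 * (height w + 1 - 1))%Z with (height w) by lia.
  - intros r. destruct (Hc (1 - r)%Z) as [u [v [Hw [q Hq]]]].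
    destruct Hh as [q' Hq'].
    exists (rev v), (rev u). split.
    + rewrite Hw, rev_app_distr. simpl. now rewrite <- app_assoc.
    + exists (q' - q)%Z.
      assert (E : w = (u ++ [sym_s]) ++ v) by now rewrite <- app_assoc.
      rewrite height_app, height_rev, turn_rev. simpl height.
      rewrite E in Ht, Hq'. rewrite turn_app in Ht. rewrite height_app in Hq'.
      destruct (turn_unit v) as [Ev|Ev]; rewrite Ev in *.
      * replace (turn (u ++ [sym_s])) with 1%Z in Hq' by lia. lia.
      * replace (turn (u ++ [sym_s])) with (-1)%Z in Hq' by lia. lia.
Qed.

Lemma balanced_E (w w' : list symbol) : E_equiv w w' -> balanced w -> balanced w'.
Proof.
  intros H Hw. apply E_equiv_rot in H.
  assert (G : forall t t', rot_equiv t t' -> balanced t -> balanced t').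
  { intros t t' Ht. apply rot_equiv_swap_inv in Ht.
    destruct Ht as [u [v [-> ->]]]. apply balanced_swap. }
  destruct H as [H|H]; [eauto|].
  apply G in H; [|easy]. apply balanced_rev in H. now rewrite rev_involutive in H.
Qed.

(** * Feasibility as balance *)

Lemma count_s_word (A : list nat) : count_s (word A) = length A.
Proof.
  induction A as [|x A IH]; [easy|]. simpl. rewrite !count_s_app, IH.
  replace (count_s (repeat sym_p x)) with 0%nat; [easy|].
  induction x; easy.
Qed.

Lemma turn_word (A : list nat) : turn (word A) = ((-1) ^ Z.of_nat (length A))%Z.
Proof.
  induction A as [|x A IH]; [easy|].
  cbn [word flat_map length]. fold (word A).
  rewrite Nat2Z.inj_succ, Z.pow_succ_r by lia. rewrite !turn_app, IH.
  replace (turn (repeat sym_p x)) with 1%Z; [cbn [turn flip]; ring|].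
  induction x as [|x IHx]; cbn [turn flip repeat]; lia.
Qed.

Lemma height_block (x : nat) :
  height (repeat sym_p x ++ [sym_s]) = (Z.of_nat x + 1)%Z.
Proof. induction x as [|x IH]; [easy|]. cbn [repeat app height flip]. lia. Qed.

Lemma sumZ_succ (k : nat) (u : nat -> Z) :
  sumZ (S k) u = (sumZ k u + u (S k))%Z.
Proof.
  unfold sumZ. rewrite seq_S, map_app, fold_right_app. simpl.
  generalize (map u (seq 1 k)) as l. induction l as [|y l IH]; simpl; lia.
Qed.

Lemma pow_minus_one_parity (k : nat) :
  ((-1) ^ Z.of_nat k)%Z = if Nat.even k then 1%Z else (-1)%Z.
Proof.
  induction k as [|k IH]; [easy|].
  rewrite Nat2Z.inj_succ, Z.pow_succ_r, IH, Nat.even_succ, <- Nat.negb_even by lia.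
  now destruct (Nat.even k).
Qed.

Lemma height_word_firstn (A : list nat) (k : nat) :
  (k <= length A)%nat ->
  height (word (firstn k A)) =
  sumZ k (fun i => (-1) ^ Z.of_nat (i + 1) * (Z.of_nat (nth (i - 1) A 0%nat) + 1))%Z.
Proof.
  induction k as [|k IH]; intros Hk; [easy|].
  rewrite sumZ_succ, <- IH by lia.
  rewrite (firstn_succ_nth A k 0%nat) by lia.
  rewrite word_app, height_app, turn_word, length_firstn.
  simpl word. rewrite app_nil_r, height_block.
  rewrite !pow_minus_one_parity, Nat.min_l by lia.
  replace (S k + 1)%nat with (S (S k)) by lia. rewrite Nat.even_succ_succ.
  replace (S k - 1)%nat with k by lia. reflexivity.
Qed.

Lemma word_cut_s (A : list nat) (u v : list symbol) :
  word A = u ++ sym_s :: v ->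
  exists k, (1 <= k <= length A)%nat /\ u ++ [sym_s] = word (firstn k A).
Proof.
  intros H. replace (u ++ sym_s :: v) with ((u ++ [sym_s]) ++ v) in H
    by now rewrite <- app_assoc.
  destruct (word_of_last v (word_prefix _ _ _ H)) as [C ->].
  destruct (word_of_last (u ++ [sym_s])) as [B HB].
  { right. apply last_last. }
  rewrite HB, <- word_app in H. apply (f_equal gaps) in H.
  rewrite !gaps_word in H. exists (length B). subst A. split.
  - rewrite length_app. destruct B; [|simpl; lia].
    destruct u; discriminate.
  - rewrite HB, firstn_app, firstn_all, Nat.sub_diag. now rewrite app_nil_r.
Qed.

Lemma word_cut_firstn (A : list nat) (k : nat) :
  (1 <= k <= length A)%nat ->
  exists u v, word A = u ++ sym_s :: v /\ u ++ [sym_s] = word (firstn k A).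
Proof.
  intros Hk.
  assert (HB : firstn k A <> []).
  { intros E. apply (f_equal (@length nat)) in E. rewrite length_firstn in E.
    simpl in E. lia. }
  pose proof (last_word _ HB) as HL.
  assert (HW : word (firstn k A) <> []).
  { intros E. now rewrite E in HL. }
  destruct (exists_last HW) as [u [x Hu]]. rewrite Hu, last_last in HL. subst x.
  exists u, (word (skipn k A)). split; [|easy].
  rewrite <- (firstn_skipn k A) at 1. now rewrite word_app, Hu, <- app_assoc.
Qed.

(** The alternating sums in [feasible] are heights of prefixes of [word A]. In the
    first congruence the summands are not increased by one; the missing signs cancel because their
    number is even. *)
Lemma feasible_balanced (A : list nat) :
  (1 <= length A)%nat ->
  (exists m, feasible (length A) m A) <-> balanced (word A).
Proof.
  intros Hn. unfold feasible, balanced. rewrite count_s_word.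
  set (n := length A) in *.
  assert (Heven : Nat.Even n <-> turn (word A) = 1%Z).
  { rewrite turn_word, pow_minus_one_parity, <- Nat.even_spec. fold n.
    destruct (Nat.even n); easy. }
  assert (Hsum : Nat.Even n ->
    height (word A) =
    sumZ n (fun i => (-1) ^ Z.of_nat (i + 1) * Z.of_nat (nth (i - 1) A 0%nat))%Z).
  { intros He. apply Nat.even_spec in He.
    rewrite <- (firstn_all A) at 1. fold n.
    rewrite height_word_firstn by easy.
    assert (G : forall k, 
      (sumZ k (fun i => (-1) ^ Z.of_nat (i + 1) * (Z.of_nat (nth (i - 1) A 0%nat) + 1))
      = sumZ k (fun i => (-1) ^ Z.of_nat (i + 1) * Z.of_nat (nth (i - 1) A 0%nat))
        + if Nat.even k then 0 else 1)%Z).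
    { induction k as [|k IH]; [easy|].
      rewrite !sumZ_succ, IH, pow_minus_one_parity.
      replace (S k + 1)%nat with (S (S k)) by lia.
      rewrite Nat.even_succ_succ, Nat.even_succ, <- Nat.negb_even.
      destruct (Nat.even k); simpl negb; cbv match; ring. }
    rewrite G, He. ring. }
  split.
  - intros [m [_ [He [_ [Hd Hc]]]]]. split; [now apply Heven|]. split.
    + rewrite Hsum by easy. apply Z.mod_divide; [lia|easy].
    + intros r. destruct (Hc r) as [k [Hk Hr]].
      destruct (word_cut_firstn A k Hk) as [u [v [Hw Hu]]].
      exists u, v. split; [easy|]. rewrite Hu, height_word_firstn by lia.
      apply Z.mod_divide; [lia|]. rewrite Zminus_mod, Hr, Z.sub_diag.
      apply Z.mod_0_l. lia.
  - intros [Ht [Hd Hc]]. apply Heven in Ht.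
    set (x_ := fun i => Z.of_nat (nth (i - 1) A 0%nat)).
    exists (Z.to_nat (sumZ n x_)). split; [easy|]. split; [easy|]. split.
    { rewrite Z2Nat.id; [easy|]. generalize n.
      induction n0 as [|k IH]; [easy|]. rewrite sumZ_succ. unfold x_ at 2. lia. }
    split.
    + rewrite <- Hsum by easy. apply Z.mod_divide; [lia|easy].
    + intros r. destruct (Hc r) as [u [v [Hw Hr]]].
      destruct (word_cut_s A u v Hw) as [k [Hk Hu]].
      exists k. split; [easy|]. rewrite <- height_word_firstn, <- Hu by lia.
      destruct Hr as [q Hq].
      replace (height (u ++ [sym_s])) with (r + q * Z.of_nat n)%Z by lia.
      apply Z_mod_plus_full.
Qed.

(** * Angles on the circle *)

Lemma circle_eq (q q' : circle) :
  fst (proj1_sig q) = fst (proj1_sig q') ->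
  snd (proj1_sig q) = snd (proj1_sig q') -> q = q'.
Proof.
  destruct q as [[x y] H], q' as [[x' y'] H']. simpl. intros -> ->.
  f_equal. apply proof_irrelevance.
Qed.

Lemma P_eq_cos_sin (x y : R) : P x = P y <-> cos x = cos y /\ sin x = sin y.
Proof.
  split.
  - intros H. apply (f_equal (@proj1_sig _ _)) in H. simpl in H.
    now injection H.
  - intros [H H']. now apply circle_eq.
Qed.

Lemma P_add_period (x : R) (k : Z) : P (x + 2 * PI * IZR k) = P x.
Proof.
  assert (G : forall y n, P (y + 2 * PI * INR n) = P y).
  { intros y n. apply P_eq_cos_sin.
    replace (y + 2 * PI * INR n) with (y + 2 * INR n * PI) by ring.
    now rewrite cos_period, sin_period. }
  destruct (Z_le_gt_dec 0 k) as [Hk|Hk].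
  - rewrite <- (Z2Nat.id k), <- INR_IZR_INZ by easy. apply G.
  - rewrite <- (G (x + 2 * PI * IZR k) (Z.to_nat (- k))).
    f_equal. rewrite INR_IZR_INZ, Z2Nat.id, opp_IZR by lia. ring.
Qed.

Lemma P_eq (x y : R) : P x = P y <-> exists k : Z, x = y + 2 * PI * IZR k.
Proof.
  split.
  - intros H. apply P_eq_cos_sin in H. destruct H as [Hc Hs].
    assert (Hd : cos (x - y) = 1).
    { rewrite cos_minus, Hc, Hs. generalize (sin2_cos2 y). unfold Rsqr. lra. }
    replace (x - y) with (2 * ((x - y) / 2)) in Hd by field.
    rewrite cos_2a_sin in Hd.
    assert (H0 : sin ((x - y) / 2) = 0) by nra.
    apply sin_eq_0_0 in H0. destruct H0 as [k Hk]. exists k. lra.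
  - intros [k ->]. apply P_add_period.
Qed.

Lemma P_surjective (q : circle) : exists t, 0 <= t < 2 * PI /\ P t = q.
Proof.
  destruct q as [[x y] H]. simpl in H.
  assert (Hx : -1 <= x <= 1) by nra.
  pose proof (acos_bound x) as Hb. pose proof PI_RGT_0.
  assert (Hy : sin (acos x) = sqrt (y * y)).
  { rewrite sin_acos by easy. f_equal. unfold Rsqr. lra. }
  fold (Rsqr y) in Hy. rewrite sqrt_Rsqr_abs in Hy.
  destruct (Rle_or_lt 0 y) as [Hy0|Hy0].
  - exists (acos x). split; [lra|].
    apply circle_eq; simpl; [now apply cos_acos|].
    rewrite Hy. now apply Rabs_pos_eq.
  - exists (2 * PI - acos x).
    assert (acos x <> 0).
    { intros E. rewrite E, sin_0 in Hy. rewrite Rabs_left in Hy; lra. }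
    split; [lra|]. rewrite Rabs_left in Hy by lra.
    apply circle_eq; simpl.
    + rewrite cos_minus, cos_2PI, sin_2PI, cos_acos by easy. ring.
    + rewrite sin_minus, cos_2PI, sin_2PI, Hy. ring.
Qed.

Lemma period_representative (t : R) :
  exists k : Z, 0 <= t + 2 * PI * IZR k < 2 * PI.
Proof.
  destruct (P_surjective (P t)) as [t' [Hb Ht']].
  apply P_eq in Ht'. destruct Ht' as [k ->]. now exists k.
Qed.

Definition angle (q : circle) : R :=
  epsilon (inhabits 0) (fun t => 0 <= t < 2 * PI /\ P t = q).

Lemma angle_spec (q : circle) : 0 <= angle q < 2 * PI /\ P (angle q) = q.
Proof. unfold angle. apply epsilon_spec, P_surjective. Qed.

Lemma P_injective_period (x y : R) :
  0 <= x < 2 * PI -> 0 <= y < 2 * PI -> P x = P y -> x = y.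
Proof.
  intros Hx Hy H. apply P_eq in H. destruct H as [k ->].
  pose proof PI_RGT_0.
  assert (-1 < IZR k < 1) by nra.
  assert (k = 0)%Z.
  { assert (-1 < k < 1)%Z by (split; apply lt_IZR; lra). lia. }
  subst. ring.
Qed.

Lemma angle_P (x : R) : 0 <= x < 2 * PI -> angle (P x) = x.
Proof. intros H. apply P_injective_period; [apply angle_spec|easy|apply angle_spec]. Qed.

(** * Lifts of circle maps *)

(** Two lifts of the same map have the same derivative, since cosine and sine determine it. *)
Lemma Derive_unique_mod_period (g h : R -> R) (t : R) :
  locally t (fun s => P (g s) = P (h s)) ->
  ex_derive g t -> ex_derive h t -> Derive g t = Derive h t.
Proof.
  intros Hl Hg Hh.
  pose proof (locally_singleton _ _ Hl) as H0.
  apply P_eq_cos_sin in H0. destruct H0 as [Hc Hs].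
  assert (Dc : Derive (fun s => cos (g s)) t = Derive (fun s => cos (h s)) t).
  { apply Derive_ext_loc. revert Hl. apply filter_imp. intros s E.
    now apply P_eq_cos_sin in E. }
  assert (Ds : Derive (fun s => sin (g s)) t = Derive (fun s => sin (h s)) t).
  { apply Derive_ext_loc. revert Hl. apply filter_imp. intros s E.
    now apply P_eq_cos_sin in E. }
  assert (Ec : forall u : R -> R, ex_derive u t ->
    Derive (fun s => cos (u s)) t = - sin (u t) * Derive u t).
  { intros u Hu. apply is_derive_unique. auto_derive; [easy|].
    change (Derive (fun x => u x) t) with (Derive u t). ring. }
  assert (Es : forall u : R -> R, ex_derive u t ->
    Derive (fun s => sin (u s)) t = cos (u t) * Derive u t).
  { intros u Hu. apply is_derive_unique. auto_derive; [easy|].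
    change (Derive (fun x => u x) t) with (Derive u t). ring. }
  rewrite !Ec in Dc by easy. rewrite !Es in Ds by easy.
  rewrite Hc in Ds. rewrite Hs in Dc.
  pose proof (sin2_cos2 (h t)) as H1. unfold Rsqr in H1.
  rewrite <- (Rmult_1_l (Derive g t)), <- (Rmult_1_l (Derive h t)), <- H1.
  transitivity (- sin (h t) * (- sin (h t) * Derive g t)
                + cos (h t) * (cos (h t) * Derive g t)); [ring|].
  rewrite Dc, Ds. ring.
Qed.

Lemma chart_expr_locally (f : circle -> circle) (t : R) (g : R -> R) :
  chart_expr f t g -> locally t (fun s => chart_expr f s g).
Proof. apply locally_locally. Qed.

Lemma chart_Derive_unique (f : circle -> circle) (t : R) (g h : R -> R) :
  chart_expr f t g -> chart_expr f t h -> Derive g t = Derive h t.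
Proof.
  intros Hg Hh. apply Derive_unique_mod_period.
  - generalize (filter_and _ _ Hg Hh). apply filter_imp.
    intros s [[E _] [E' _]]. congruence.
  - apply locally_singleton in Hg. apply (proj2 Hg 1%nat).
  - apply locally_singleton in Hh. apply (proj2 Hh 1%nat).
Qed.

Lemma constant_of_derive_zero (f : R -> R) :
  (forall t, is_derive f t 0) -> forall x y, f x = f y.
Proof.
  intros H x y.
  destruct (MVT_gen f x y (fun _ => 0)) as [c [_ Hc]].
  - intros t _. apply H.
  - intros t _. apply derivable_continuous_pt.
    exists 0. apply is_derive_Reals, H.
  - lra.
Qed.

Lemma Derive_n_Derive (F : R -> R) (k : nat) (t : R) :
  Derive_n (Derive F) k t = Derive_n F (S k) t.
Proof.
  change (Derive F) with (Derive_n F 1). rewrite Derive_n_comp.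
  now rewrite Nat.add_1_r.
Qed.

Lemma ex_derive_n_Derive (F : R -> R) (k : nat) (t : R) :
  (forall s, ex_derive F s) -> ex_derive_n (Derive F) k t ->
  ex_derive_n F (S k) t.
Proof.
  intros H0 H. destruct k as [|k]; [apply H0|].
  apply (ex_derive_ext (Derive_n (Derive F) k)); [|exact H].
  intros s. apply Derive_n_Derive.
Qed.

Definition lift (f : circle -> circle) (F : R -> R) : Prop :=
  (forall t, f (P t) = P (F t)) /\ (forall k t, ex_derive_n F k t).

Lemma lift_chart (f : circle -> circle) (F : R -> R) (t : R) :
  lift f F -> chart_expr f t F.
Proof.
  intros [H H']. unfold chart_expr. apply filter_forall. intros s. split; auto.
Qed.

(** No patching of local expressions is needed: their derivatives agree on overlaps and so form one
    function [phi] on the line. With [F] an antiderivative of [phi], rotating [f] back by the angle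
    [F] gives a point with zero derivative, which therefore stays at angle zero. *)
Lemma smooth_has_lift (f : circle -> circle) :
  smooth f -> exists F, lift f F.
Proof.
  intros Hf.
  set (G := fun t => epsilon (inhabits (fun _ : R => 0)) (chart_expr f t)).
  assert (HG : forall t, chart_expr f t (G t)).
  { intros t. apply epsilon_spec, Hf. }
  set (phi := fun t => Derive (G t) t).
  assert (Hphi : forall t : R, locally t (fun s => phi s = Derive (G t) s)).
  { intros t. generalize (chart_expr_locally f t (G t) (HG t)).
    apply filter_imp. intros s Hs. now apply (chart_Derive_unique f). }
  assert (Cphi : forall t : R, continuous phi t).
  { intros t. apply (ex_derive_continuous phi t).
    apply (ex_derive_ext_loc (Derive (G t))).
    - generalize (Hphi t). apply filter_imp. now intros s ->.
    - apply (proj2 (locally_singleton _ _ (HG t)) 2%nat). }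
  destruct (P_surjective (f (P 0))) as [y0 [_ Hy0]].
  set (F := fun t => y0 + RInt phi 0 t).
  assert (DF : forall t : R, is_derive F t (phi t)).
  { intros t. unfold F. replace (phi t) with (0 + phi t) by ring.
    apply (is_derive_plus (fun _ => y0)); [apply (is_derive_const y0)|].
    apply (is_derive_RInt phi (RInt phi 0) 0 t); [|apply Cphi].
    apply filter_forall. intros b. apply (RInt_correct phi).
    apply (ex_RInt_continuous phi). intros z _. apply Cphi. }
  set (X := fun t => fst (proj1_sig (f (P t)))).
  set (Y := fun t => snd (proj1_sig (f (P t)))).
  assert (DX : forall t : R, is_derive X t (- Y t * phi t)).
  { intros t. apply (is_derive_ext_loc (fun s => cos (G t s))).
    - generalize (HG t). unfold chart_expr. apply filter_imp. intros s [E _].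
      unfold X. now rewrite E.
    - pose proof (locally_singleton _ _ (HG t)) as [E H].
      unfold Y. rewrite E. simpl. auto_derive; [apply (H 1%nat)|].
      change (Derive (fun x => G t x) t) with (phi t). ring. }
  assert (DY : forall t : R, is_derive Y t (X t * phi t)).
  { intros t. apply (is_derive_ext_loc (fun s => sin (G t s))).
    - generalize (HG t). unfold chart_expr. apply filter_imp. intros s [E _].
      unfold Y. now rewrite E.
    - pose proof (locally_singleton _ _ (HG t)) as [E H].
      unfold X. rewrite E. simpl. auto_derive; [apply (H 1%nat)|].
      change (Derive (fun x => G t x) t) with (phi t). ring. }
  assert (XY0 : X 0 = cos y0 /\ Y 0 = sin y0).
  { unfold X, Y. rewrite <- Hy0. easy. }
  assert (F0 : F 0 = y0).
  { unfold F. rewrite RInt_point. unfold zero; simpl. ring. }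
  assert (HU : forall t, X t * cos (F t) + Y t * sin (F t) = 1).
  { intros t.
    rewrite (constant_of_derive_zero
      (fun t => X t * cos (F t) + Y t * sin (F t))) with (y := 0).
    - rewrite F0, (proj1 XY0), (proj2 XY0).
      generalize (sin2_cos2 y0). unfold Rsqr. lra.
    - intros s. auto_derive.
      + repeat split; eexists; eauto.
      + rewrite (is_derive_unique (fun x : R => X x) s _ (DX s)),
          (is_derive_unique (fun x : R => Y x) s _ (DY s)),
          (is_derive_unique (fun x : R => F x) s _ (DF s)).
        ring. }
  assert (HV : forall t, Y t * cos (F t) - X t * sin (F t) = 0).
  { intros t.
    rewrite (constant_of_derive_zero
      (fun t => Y t * cos (F t) - X t * sin (F t))) with (y := 0).
    - rewrite F0, (proj1 XY0), (proj2 XY0). ring.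
    - intros s. auto_derive.
      + repeat split; eexists; eauto.
      + rewrite (is_derive_unique (fun x : R => X x) s _ (DX s)),
          (is_derive_unique (fun x : R => Y x) s _ (DY s)),
          (is_derive_unique (fun x : R => F x) s _ (DF s)).
        ring. }
  exists F. split.
  - intros t. specialize (HU t). specialize (HV t).
    pose proof (sin2_cos2 (F t)) as HF. unfold Rsqr in HF.
    apply circle_eq.
    + change (X t = cos (F t)). transitivity (cos (F t) * (X t * cos (F t) + Y t * sin (F t))
        - sin (F t) * (Y t * cos (F t) - X t * sin (F t))
        + X t * (1 - (sin (F t) * sin (F t) + cos (F t) * cos (F t)))); [ring|].
      rewrite HU, HV, HF. ring.
    + change (Y t = sin (F t)). transitivity (sin (F t) * (X t * cos (F t) + Y t * sin (F t))
        + cos (F t) * (Y t * cos (F t) - X t * sin (F t))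
        + Y t * (1 - (sin (F t) * sin (F t) + cos (F t) * cos (F t)))); [ring|].
      rewrite HU, HV, HF. ring.
  - intros [|k] t; [exact I|].
    apply ex_derive_n_Derive; [intros s; eexists; apply DF|].
    apply (ex_derive_n_ext_loc (Derive (G t))).
    + generalize (Hphi t). apply filter_imp. intros s <-.
      symmetry. apply is_derive_unique, DF.
    + pose proof (locally_singleton _ _ (HG t)) as [_ H].
      destruct k as [|k]; [exact I|].
      apply (ex_derive_ext (Derive_n (G t) (S k))); [|exact (H (S (S k)))].
      intros s. symmetry. apply Derive_n_Derive.
Qed.

Lemma lift_Derive_chart (f : circle -> circle) (F g : R -> R) (t : R) :
  lift f F -> chart_expr f t g ->
  locally t (fun s => Derive g s = Derive F s).
Proof.
  intros HF Hg. generalize (chart_expr_locally f t g Hg). apply filter_imp.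
  intros s Hs. apply (chart_Derive_unique f s); [easy|]. now apply lift_chart.
Qed.

Lemma lift_Derive_period (f : circle -> circle) (F : R -> R) (k : Z) (t : R) :
  lift f F -> Derive F (t + 2 * PI * IZR k) = Derive F t.
Proof.
  intros [HF HS].
  transitivity (Derive (fun s => F (s + 2 * PI * IZR k)) t).
  - symmetry. apply is_derive_unique. auto_derive.
    + apply (HS 1%nat).
    + apply Rmult_1_l.
  - apply Derive_unique_mod_period.
    + apply filter_forall. intros s. now rewrite <- !HF, P_add_period.
    + auto_derive. apply (HS 1%nat).
    + apply (HS 1%nat).
Qed.

Lemma lift_Derive_2_period (f : circle -> circle) (F : R -> R) (k : Z) (t : R) :
  lift f F -> Derive_n F 2 (t + 2 * PI * IZR k) = Derive_n F 2 t.
Proof.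
  intros HF. change (Derive (Derive F) (t + 2 * PI * IZR k) = Derive (Derive F) t).
  transitivity (Derive (fun s => Derive F (s + 2 * PI * IZR k)) t).
  - symmetry. apply is_derive_unique. auto_derive.
    + apply (proj2 HF 2%nat).
    + apply Rmult_1_l.
  - apply Derive_ext. intros s. now apply (lift_Derive_period f).
Qed.

Lemma lift_degree (f : circle -> circle) (F : R -> R) :
  lift f F -> exists D : Z, forall t, F (t + 2 * PI) = F t + 2 * PI * IZR D.
Proof.
  intros HF.
  assert (HD : P (F (0 + 2 * PI * IZR 1)) = P (F 0)).
  { destruct HF as [HF _]. now rewrite <- !HF, P_add_period. }
  apply P_eq in HD. destruct HD as [D HD]. exists D. intros t.
  assert (E : F (t + 2 * PI) - F t = F (0 + 2 * PI) - F 0).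
  { apply (constant_of_derive_zero (fun t => F (t + 2 * PI) - F t)).
    intros s. auto_derive.
    - repeat split; apply (proj2 HF 1%nat).
    - pose proof (lift_Derive_period f F 1 s HF) as E.
      rewrite Rmult_1_r in E.
      change (Derive (fun x => F x) (s + 2 * PI)) with (Derive F (s + 2 * PI)).
      change (Derive (fun x => F x) s) with (Derive F s).
      rewrite E. ring. }
  rewrite Rmult_1_r in HD. lra.
Qed.

Lemma lift_singular (f : circle -> circle) (F : R -> R) (t : R) :
  lift f F -> singular f (P t) <-> Derive F t = 0.
Proof.
  intros HF. split.
  - intros [t' [g [Ht' [Hg H0]]]].
    apply P_eq in Ht'. destruct Ht' as [k ->].
    rewrite <- H0, <- (lift_Derive_period f F k t) by easy.
    symmetry. apply (locally_singleton _ _ (lift_Derive_chart f F g _ HF Hg)).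
  - intros H0. exists t, F. split; [easy|]. split; [now apply lift_chart|easy].
Qed.

Lemma lift_morse (f : circle -> circle) (F : R -> R) (t : R) :
  lift f F -> morse f (P t) <-> Derive F t = 0 /\ Derive_n F 2 t <> 0.
Proof.
  intros HF. split.
  - intros [t' [g [Ht' [Hg [H0 H2]]]]].
    split; [apply (lift_singular f F t HF); now exists t', g|].
    apply P_eq in Ht'. destruct Ht' as [k ->].
    intros E. apply H2. rewrite <- E, <- (lift_Derive_2_period f F k t HF).
    apply (Derive_ext_loc (Derive g)). now apply (lift_Derive_chart f).
  - intros [H0 H2]. exists t, F. repeat split; try easy. now apply lift_chart.
Qed.

(** * Sorted lists and periodic sets of reals *)

Lemma sorted_permutation (l : list R) :
  NoDup l -> exists l', StronglySorted Rlt l' /\ Permutation l l'.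
Proof.
  induction l as [|x l IH]; intros H; [exists []; split; constructor|].
  inversion_clear H as [|? ? Hx Hl]. destruct (IH Hl) as [l' [Hs Hp]].
  assert (Hx' : ~ In x l').
  { intros E. apply Hx. now apply (Permutation_in x (Permutation_sym Hp)). }
  clear IH Hx Hl.
  enough (G : exists l'', StronglySorted Rlt l'' /\ Permutation (x :: l') l'').
  { destruct G as [l'' [G G']]. exists l''. split; [easy|].
    eapply Permutation_trans; [now apply perm_skip, Hp|easy]. }
  clear Hp l. induction Hs as [|y l' Hs IH Hy].
  - exists [x]. split; [repeat constructor|easy].
  - destruct (Rlt_or_le x y) as [Hlt|Hle].
    + exists (x :: y :: l'). split; [|easy].
      constructor; [now constructor|]. constructor; [easy|].
      revert Hy. apply Forall_impl. intros z Hz. lra.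
    + assert (y < x) by (destruct Hle; [easy|subst; exfalso; apply Hx'; now left]).
      destruct IH as [l'' [H1 H2]]; [intros E; apply Hx'; now right|].
      exists (y :: l''). split.
      * constructor; [easy|]. apply (Permutation_Forall H2). now constructor.
      * eapply Permutation_trans; [apply perm_swap|]. now apply perm_skip.
Qed.

Lemma sorted_NoDup (l : list R) : StronglySorted Rlt l -> NoDup l.
Proof.
  induction 1 as [|x l Hs IH Hx]; constructor; [|easy].
  intros E. rewrite Forall_forall in Hx. apply Hx in E. lra.
Qed.

Lemma sorted_nth (l : list R) (i j : nat) :
  StronglySorted Rlt l -> (i < j < length l)%nat -> nth i l 0 < nth j l 0.
Proof.
  intros H. revert i j. induction H as [|x l Hs IH Hx]; intros i j Hij; simpl in Hij.
  - lia.
  - destruct j as [|j]; [lia|]. destruct i as [|i]; simpl.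
    + rewrite Forall_forall in Hx. apply Hx, nth_In. lia.
    + apply IH. lia.
Qed.

Lemma sorted_unique (l l' : list R) :
  StronglySorted Rlt l -> StronglySorted Rlt l' ->
  (forall t, In t l <-> In t l') -> l = l'.
Proof.
  intros H. revert l'. induction H as [|x l Hs IH Hx]; intros l' H' E.
  - destruct l' as [|y l']; [easy|]. destruct (proj2 (E y)). now left.
  - destruct H' as [|y l' Hs' Hy]; [destruct (proj1 (E x)); now left|].
    rewrite Forall_forall in Hx, Hy.
    assert (x = y).
    { destruct (proj1 (E x)) as [->|H1]; [now left|easy|].
      destruct (proj2 (E y)) as [->|H2]; [now left|easy|].
      apply Hx in H2. apply Hy in H1. lra. }
    subst y. f_equal. apply IH; [easy|]. intros t. split; intros Ht.
    + destruct (proj1 (E t)) as [<-|]; [now right| |easy]. apply Hx in Ht. lra.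
    + destruct (proj2 (E t)) as [<-|]; [now right| |easy]. apply Hy in Ht. lra.
Qed.

(** The increasing enumeration over [Z] of the [2 * PI]-periodic set whose elements in one period are
    listed by [l]. *)
Definition periodic_enum (l : list R) (j : Z) : R :=
  nth (Z.to_nat (j mod Z.of_nat (length l))) l 0
  + 2 * PI * IZR (j / Z.of_nat (length l)).

Lemma periodic_enum_period (l : list R) (j k : Z) :
  l <> [] ->
  periodic_enum l (j + k * Z.of_nat (length l)) = periodic_enum l j + 2 * PI * IZR k.
Proof.
  intros Hl. assert (length l <> 0%nat) by (now destruct l).
  unfold periodic_enum. rewrite Z_mod_plus_full, Z_div_plus_full, plus_IZR by lia.
  ring.
Qed.

Lemma periodic_enum_nth (l : list R) (k : nat) :
  (k < length l)%nat -> periodic_enum l (Z.of_nat k) = nth k l 0.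
Proof.
  intros Hk. unfold periodic_enum.
  rewrite Z.mod_small, Z.div_small, Nat2Z.id by lia. ring.
Qed.

Lemma periodic_enum_increasing (l : list R) (i j : Z) :
  l <> [] -> StronglySorted Rlt l -> (forall t, In t l -> 0 <= t < 2 * PI) ->
  (i < j)%Z -> periodic_enum l i < periodic_enum l j.
Proof.
  intros Hl Hs Hb Hij.
  assert (H0 : (0 < Z.of_nat (length l))%Z) by (destruct l; [easy|simpl; lia]).
  unfold periodic_enum. set (N := Z.of_nat (length l)) in *.
  pose proof (Z.div_mod i N ltac:(lia)). pose proof (Z.div_mod j N ltac:(lia)).
  pose proof (Z.mod_pos_bound i N H0). pose proof (Z.mod_pos_bound j N H0).
  pose proof PI_RGT_0.
  assert (Hi : 0 <= nth (Z.to_nat (i mod N)) l 0 < 2 * PI) by (apply Hb, nth_In; lia).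
  assert (Hj : 0 <= nth (Z.to_nat (j mod N)) l 0 < 2 * PI) by (apply Hb, nth_In; lia).
  assert (i / N <= j / N)%Z by (apply Z.div_le_mono; lia).
  destruct (Z.eq_dec (i / N) (j / N)) as [E|E].
  - rewrite E in *. apply Rplus_lt_compat_r, sorted_nth; [easy|lia].
  - assert (Hle : (i / N + 1 <= j / N)%Z) by lia.
    apply IZR_le in Hle. rewrite plus_IZR in Hle. nra.
Qed.

Lemma periodic_enum_lt_inv (l : list R) (i j : Z) :
  l <> [] -> StronglySorted Rlt l -> (forall t, In t l -> 0 <= t < 2 * PI) ->
  periodic_enum l i < periodic_enum l j -> (i < j)%Z.
Proof.
  intros Hl Hs Hb H. destruct (Z_lt_ge_dec i j) as [|Hge]; [easy|].
  destruct (Z.eq_dec i j) as [->|E]; [lra|].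
  pose proof (periodic_enum_increasing l j i Hl Hs Hb ltac:(lia)). lra.
Qed.

Lemma periodic_enum_injective (l : list R) (i j : Z) :
  l <> [] -> StronglySorted Rlt l -> (forall t, In t l -> 0 <= t < 2 * PI) ->
  periodic_enum l i = periodic_enum l j -> i = j.
Proof.
  intros Hl Hs Hb H. destruct (Z.lt_total i j) as [E|[E|E]]; [|easy|];
    apply (periodic_enum_increasing l _ _ Hl Hs Hb) in E; lra.
Qed.

Lemma periodic_enum_spec (S : circle -> Prop) (l : list R) (t : R) :
  l <> [] -> (forall t, In t l <-> 0 <= t < 2 * PI /\ S (P t)) ->
  S (P t) <-> exists j, t = periodic_enum l j.
Proof.
  intros Hl HS.
  assert (H0 : (0 < Z.of_nat (length l))%Z) by (destruct l; [easy|simpl; lia]).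
  split.
  - intros Ht. destruct (period_representative t) as [k Hk].
    assert (Hin : In (t + 2 * PI * IZR k) l) by (apply HS; now rewrite P_add_period).
    apply (In_nth _ _ 0) in Hin. destruct Hin as [m [Hm Em]].
    exists (Z.of_nat m + (- k) * Z.of_nat (length l))%Z.
    rewrite periodic_enum_period, periodic_enum_nth, Em, opp_IZR by easy. ring.
  - intros [j ->]. unfold periodic_enum. rewrite P_add_period.
    apply HS, nth_In.
    pose proof (Z.mod_pos_bound j (Z.of_nat (length l)) H0). lia.
Qed.

(** * Signs of a function next to a point *)

(** The sign [sigma] selects the side of [x], so that the left and right limits are treated at once. *)
Lemma sign_limit (g : R -> R) (x e sigma eta : R) :
  continuous g x -> 0 < eta -> Rabs sigma = 1 ->
  (forall h, 0 < h < eta -> 0 < e * g (x + sigma * h)) -> 0 <= e * g x.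
Proof.
  intros Hg Heta Hsg H. destruct (Rle_or_lt 0 (e * g x)) as [|Hneg]; [easy|].
  assert (Hc : continuous (fun t => e * g t) x).
  { apply (continuous_mult (fun _ => e) g); [apply continuous_const|easy]. }
  apply continuity_pt_filterlim in Hc.
  destruct (Hc (- (e * g x))) as [d [Hd Hd']]; [lra|].
  set (h := Rmin (d / 2) (eta / 2)).
  assert (Hh : 0 < h) by (apply Rmin_pos; lra).
  pose proof (Rmin_l (d / 2) (eta / 2)). pose proof (Rmin_r (d / 2) (eta / 2)).
  fold h in H0, H1.
  specialize (H h ltac:(lra)).
  specialize (Hd' (x + sigma * h)). simpl in Hd'. unfold R_dist in Hd'.
  assert (Hsh : Rabs (sigma * h) = h) by (rewrite Rabs_mult, Hsg, Rabs_pos_eq; lra).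
  assert (Rabs (e * g (x + sigma * h) - e * g x) < - (e * g x)).
  { apply Hd'. split.
    - split; [exact I|]. intros E.
      assert (sigma * h = 0) by lra. rewrite H2, Rabs_R0 in Hsh. lra.
    - replace (x + sigma * h - x) with (sigma * h) by ring. lra. }
  apply Rabs_def2 in H2. lra.
Qed.

(** At a zero it is the derivative that dictates the sign, and oppositely on the two sides; for a
    derivative [g] this is the change of direction at a Morse point. *)
Lemma sign_derive_limit (g : R -> R) (x d e sigma eta : R) :
  is_derive g x d -> g x = 0 -> 0 < eta -> Rabs sigma = 1 ->
  (forall h, 0 < h < eta -> 0 < e * g (x + sigma * h)) -> 0 <= e * sigma * d.
Proof.
  intros Hg H0 Heta Hsg H.
  destruct (Rle_or_lt 0 (e * sigma * d)) as [|Hneg]; [easy|].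
  assert (He : e <> 0) by (intros E; rewrite E in Hneg; lra).
  assert (Hsg2 : sigma * sigma = 1).
  { change (Rsqr sigma = 1). rewrite Rsqr_abs, Hsg. unfold Rsqr. ring. }
  apply is_derive_Reals in Hg.
  destruct (Hg (Rabs d)) as [del Hdel].
  { apply Rabs_pos_lt. intros E. rewrite E in Hneg. lra. }
  set (h := Rmin (del / 2) (eta / 2)).
  assert (Hdp : 0 < del) by apply cond_pos.
  assert (Hh : 0 < h) by (apply Rmin_pos; lra).
  pose proof (Rmin_l (del / 2) (eta / 2)). pose proof (Rmin_r (del / 2) (eta / 2)).
  fold h in H1, H2.
  specialize (H h ltac:(lra)).
  assert (Hsh : Rabs (sigma * h) = h) by (rewrite Rabs_mult, Hsg, Rabs_pos_eq; lra).
  assert (Hsh0 : sigma * h <> 0) by (intros E; rewrite E, Rabs_R0 in Hsh; lra).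
  specialize (Hdel (sigma * h) Hsh0 ltac:(lra)).
  rewrite H0, Rminus_0_r in Hdel.
  set (y := g (x + sigma * h)) in *.
  assert (Hy : y / (sigma * h) = sigma * y / h).
  { field_simplify_eq; [nra|]. split; [lra|]. intros E. rewrite E in Hsh0. lra. }
  rewrite Hy in Hdel.
  assert (Hprod : 0 < e * sigma * (sigma * y / h)).
  { replace (e * sigma * (sigma * y / h)) with (e * y * / h * (sigma * sigma)) by (unfold Rdiv; ring).
    rewrite Hsg2, Rmult_1_r. apply Rmult_lt_0_compat; [easy|]. now apply Rinv_0_lt_compat. }
  set (z := sigma * y / h) in *. set (c := e * sigma) in *.
  apply Rabs_def2 in Hdel.
  destruct (Rle_or_lt 0 d).
  - rewrite Rabs_pos_eq in Hdel by easy. nra.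
  - rewrite Rabs_left in Hdel by easy. nra.
Qed.

Lemma constant_sign (g : R -> R) (x y : R) :
  (forall t, continuous g t) -> x < y -> (forall t, x < t < y -> g t <> 0) ->
  exists e : Z, (e = 1 \/ e = -1)%Z /\ forall t, x < t < y -> 0 < IZR e * g t.
Proof.
  intros Hc Hxy H0.
  assert (G : forall s t, x < s < y -> x < t < y -> 0 < g s -> 0 < g t).
  { intros s t Hs Ht Hg. destruct (Rtotal_order 0 (g t)) as [|[E|E]]; [easy| |].
    - now destruct (H0 t Ht).
    - destruct (IVT_gen g s t 0) as [c [Hb Hc']].
      + intros u. apply continuity_pt_filterlim, Hc.
      + rewrite Rmin_right, Rmax_left by lra. lra.
      + exfalso. apply (H0 c); [|easy].
        unfold Rmin, Rmax in Hb. destruct (Rle_dec s t); lra. }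
  set (m := (x + y) / 2). assert (Hm : x < m < y) by (unfold m; lra).
  destruct (Rtotal_order 0 (g m)) as [E|[E|E]].
  - exists 1%Z. split; [now left|]. intros t Ht. specialize (G m t Hm Ht E). lra.
  - now destruct (H0 m Hm).
  - exists (-1)%Z. split; [now right|]. intros t Ht.
    destruct (Rtotal_order 0 (g t)) as [E'|[E'|E']]; [|now destruct (H0 t Ht)|lra].
    specialize (G t m Ht Hm E'). lra.
Qed.

Lemma derive_sign_increasing (F : R -> R) (e x y : R) :
  (forall t, ex_derive F t) -> x < y ->
  (forall t, x < t < y -> 0 < e * Derive F t) -> e * F x < e * F y.
Proof.
  intros HF Hxy H.
  destruct (MVT_cor2 (fun t => e * F t) (fun t => e * Derive F t) x y Hxy)
    as [c [Hc Hb]].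
  - intros t _. apply is_derive_Reals, (is_derive_scal F).
    now apply Derive_correct.
  - specialize (H c Hb). nra.
Qed.

(** * The word of a stable map is balanced *)

Lemma functional_choice {X Y : Type} (R : X -> Y -> Prop) :
  (forall x, exists y, R x y) -> exists g, forall x, R x (g x).
Proof.
  intros H.
  exists (fun x => proj1_sig (constructive_indefinite_description _ (H x))).
  intros x. apply proj2_sig.
Qed.

Lemma T_singular (f : circle -> circle) (a : R) :
  T f a = sym_s <-> singular f (P a).
Proof. unfold T. now destruct excluded_middle_informative. Qed.

(** There are as many singular values as singular points because [f] separates the latter. *)
Lemma singular_value_list (f : circle -> circle) (l : list R) :
  stable f -> StronglySorted Rlt l -> (forall t, In t l <-> A_set f t) ->
  exists vl, StronglySorted Rlt vl /\ length vl = count_s (map (T f) l) /\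
    forall y, In y vl <-> 0 <= y < 2 * PI /\ Delta f (P y).
Proof.
  intros [_ [_ Hinj]] Hs Hl.
  set (cl := filter (fun a => match T f a with sym_s => true | _ => false end) l).
  assert (Hcl : forall a, In a cl <-> 0 <= a < 2 * PI /\ singular f (P a)).
  { intros a. unfold cl. rewrite filter_In, Hl. split.
    - intros [[Ha _] Hsa]. split; [easy|]. apply T_singular.
      now destruct (T f a).
    - intros [Ha Hsa]. split; [split; [easy|]; now exists (P a)|].
      apply T_singular in Hsa. now rewrite Hsa. }
  assert (Hnd : NoDup (map (fun a => angle (f (P a))) cl)).
  { apply FinFun.Injective_map_NoDup_in.
    - intros a b Ha Hb E. apply Hcl in Ha, Hb.
      apply P_injective_period; [easy|easy|]. apply Hinj; [easy|easy|].
      rewrite <- (proj2 (angle_spec (f (P a)))), E. apply angle_spec.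
    - now apply NoDup_filter, sorted_NoDup. }
  destruct (sorted_permutation _ Hnd) as [vl [Hvs Hp]].
  exists vl. split; [easy|]. split.
  - rewrite <- (Permutation_length Hp), length_map. unfold cl, count_s.
    clear. induction l as [|a l IH]; [easy|]. simpl.
    destruct (T f a); simpl; now rewrite IH.
  - intros y. split.
    + intros Hy. apply (Permutation_in y (Permutation_sym Hp)) in Hy.
      apply in_map_iff in Hy. destruct Hy as [a [<- Ha]]. apply Hcl in Ha.
      destruct (angle_spec (f (P a))) as [Hb E]. split; [easy|]. rewrite E.
      now exists (P a).
    + intros [Hy [q [Hq E]]]. apply (Permutation_in y Hp).
      apply in_map_iff. exists (angle q). destruct (angle_spec q) as [Hb Eq].
      split; [rewrite Eq, E; now apply angle_P|].
      apply Hcl. now rewrite Eq.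
Qed.

(** [e] is the direction on the edge following each index; the walk of [w] is read off from the edge
    that leads to its first letter, hence the index [-1]. *)
Lemma walk_along_word (w : list symbol) (h e : Z -> Z) :
  (forall j, h (j + 1) = h j + e j)%Z ->
  (forall k, (k < length w)%nat ->
     e (Z.of_nat k) = flip (nth k w sym_p) * e (Z.of_nat k - 1))%Z ->
  forall k, (k <= length w)%nat ->
    e (Z.of_nat k - 1)%Z = (e (-1) * turn (firstn k w))%Z /\
    h (Z.of_nat k - 1)%Z = (h (-1) + e (-1) * height (firstn k w))%Z.
Proof.
  intros Hh He k. induction k as [|k IH]; intros Hk.
  - cbn [firstn turn height]. change (Z.of_nat 0 - 1)%Z with (-1)%Z. split; ring.
  - destruct IH as [IHe IHh]; [lia|].
    replace (Z.of_nat (S k) - 1)%Z with (Z.of_nat k) by lia.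
    rewrite (firstn_succ_nth w k sym_p), turn_app, height_app by lia.
    cbn [turn height]. split.
    + rewrite He, IHe by lia. ring.
    + replace (Z.of_nat k) with (Z.of_nat k - 1 + 1)%Z by lia.
      rewrite Hh, IHe, IHh. ring.
Qed.

(** The function [h] numbers the singular value met at each hit; it is a walk of the kind described by
    [turn] and [height]. *)
Lemma stable_word_balanced (f : circle -> circle) (w : list symbol) :
  smooth f -> stable f -> is_Ast f w -> (1 <= count_s w)%nat -> balanced w.
Proof.
  intros Hsm Hst [l [Hs [Hl Hw]]] Hn.
  destruct (smooth_has_lift f Hsm) as [F HF].
  destruct (singular_value_list f l Hst Hs Hl) as [vl [Hvs [Hvn Hvl]]].
  rewrite <- Hw in Hvn.
  assert (Hvl0 : vl <> []) by (intros E; rewrite E in Hvn; simpl in Hvn; lia).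
  assert (Hl0 : l <> []).
  { intros E. rewrite E in Hw. rewrite Hw in Hn. unfold count_s in Hn. simpl in Hn. lia. }
  assert (Hlb : forall t, In t l -> 0 <= t < 2 * PI) by (intros t Ht; now apply Hl).
  assert (Hvb : forall t, In t vl -> 0 <= t < 2 * PI) by (intros t Ht; now apply Hvl).
  set (a := periodic_enum l). set (v := periodic_enum vl).
  assert (Hhit : forall t, Delta f (f (P t)) <-> exists j, t = a j).
  { intros t. now apply (periodic_enum_spec (fun q => Delta f (f q))). }
  assert (Hval : forall y, Delta f (P y) <-> exists j, y = v j).
  { intros y. now apply (periodic_enum_spec (Delta f)). }
  assert (Ha : forall i j, (i < j)%Z -> a i < a j).
  { intros i j. now apply periodic_enum_increasing. }
  assert (Ha' : forall i j, a i < a j -> (i < j)%Z).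
  { intros i j. now apply periodic_enum_lt_inv. }
  assert (Hv : forall i j, (i < j)%Z -> v i < v j).
  { intros i j. now apply periodic_enum_increasing. }
  assert (Hv' : forall i j, v i < v j -> (i < j)%Z).
  { intros i j. now apply periodic_enum_lt_inv. }
  assert (Hvinj : forall i j, v i = v j -> i = j).
  { intros i j. now apply periodic_enum_injective. }
  assert (Hex : forall t : R, ex_derive F t) by (intros t; apply (proj2 HF 1%nat)).
  assert (Hex2 : forall t : R, ex_derive (Derive F) t) by (intros t; apply (proj2 HF 2%nat)).
  assert (HFc : forall t : R, continuous F t) by (intros t; now apply (ex_derive_continuous F)).
  assert (HDc : forall t : R, continuous (Derive F) t)
    by (intros t; now apply (ex_derive_continuous (Derive F))).
  assert (Hsing : forall t, singular f (P t) <-> Derive F t = 0)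
    by (intros t; now apply lift_singular).
  assert (HFa : forall j, exists k, F (a j) = v k).
  { intros j. apply Hval. rewrite <- (proj1 HF). apply Hhit. now exists j. }
  destruct (functional_choice _ HFa) as [h Hh].
  assert (Hgap : forall j t, a j < t < a (j + 1)%Z -> ~ Delta f (f (P t))).
  { intros j t [H1 H2] E. apply Hhit in E. destruct E as [i ->].
    apply Ha' in H1, H2. lia. }
  (* Hits include the critical points, so the derivative keeps its sign between hits. *)
  assert (Hsgn : forall j, exists e : Z, (e = 1 \/ e = -1)%Z /\
     forall t, a j < t < a (j + 1)%Z -> 0 < IZR e * Derive F t).
  { intros j. apply constant_sign; [easy|apply Ha; lia|].
    intros t Ht E. apply (Hgap j t Ht). exists (P t). split; [now apply Hsing|easy]. }
  destruct (functional_choice _ Hsgn) as [e He].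
  (* By the intermediate value theorem an index strictly between those of two consecutive hits would
     produce another hit between them. *)
  assert (Hno : forall j m, ~ (Rmin (F (a j)) (F (a (j + 1)%Z)) < v m
                               < Rmax (F (a j)) (F (a (j + 1)%Z)))).
  { intros j m Hm. pose proof (Ha j (j + 1)%Z ltac:(lia)) as Hj.
    destruct (IVT_gen F (a j) (a (j + 1)%Z) (v m)) as [c [Hc Ec]].
    - intros u. apply continuity_pt_filterlim, HFc.
    - lra.
    - rewrite Rmin_left, Rmax_right in Hc by lra.
      assert (c <> a j /\ c <> a (j + 1)%Z).
      { split; intros ->; rewrite Ec in Hm; revert Hm; unfold Rmin, Rmax;
          destruct Rle_dec; lra. }
      apply (Hgap j c); [lra|]. rewrite (proj1 HF), Ec. apply Hval. now exists m. }
  assert (Hstep : forall j, h (j + 1)%Z = (h j + e j)%Z).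
  { intros j. destruct (He j) as [He1 Hpos].
    pose proof (derive_sign_increasing F (IZR (e j)) (a j) (a (j + 1)%Z) Hex
      (Ha j (j + 1)%Z ltac:(lia)) Hpos) as Hm.
    specialize (Hno j). rewrite !Hh in Hm, Hno.
    destruct He1 as [E|E]; rewrite E in *.
    - assert (v (h j) < v (h (j + 1)%Z)) as H1 by lra. rewrite Rmin_left, Rmax_right in Hno by lra.
      apply Hv' in H1. destruct (Z.eq_dec (h (j + 1)%Z) (h j + 1)) as [|Hne]; [easy|].
      exfalso. apply (Hno (h j + 1)%Z). split; apply Hv; lia.
    - assert (v (h (j + 1)%Z) < v (h j)) as H1 by lra. rewrite Rmin_right, Rmax_left in Hno by lra.
      apply Hv' in H1. destruct (Z.eq_dec (h (j + 1)%Z) (h j + -1)) as [|Hne]; [easy|].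
      exfalso. apply (Hno (h j - 1)%Z). split; apply Hv; lia. }
  (* Compare the one-sided signs of the derivative at [a j]: continuity decides at a regular hit,
     the nonzero second derivative at a singular one. *)
  assert (Hflip : forall j, e j = (flip (T f (a j)) * e (j - 1))%Z).
  { intros j. destruct (He j) as [E1 H1]. destruct (He (j - 1)%Z) as [E2 H2].
    replace (j - 1 + 1)%Z with j in H2 by lia.
    pose proof (Ha j (j + 1)%Z ltac:(lia)) as Hr.
    pose proof (Ha (j - 1)%Z j ltac:(lia)) as Hlft.
    assert (R1 : forall t, 0 < t < a (j + 1)%Z - a j ->
                   0 < IZR (e j) * Derive F (a j + 1 * t)) by (intros t Ht; apply H1; lra).
    assert (R2 : forall t, 0 < t < a j - a (j - 1)%Z ->
                   0 < IZR (e (j - 1)%Z) * Derive F (a j + -1 * t)) by (intros t Ht; apply H2; lra).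
    assert (L1 : 0 < a (j + 1)%Z - a j) by lra.
    assert (L2 : 0 < a j - a (j - 1)%Z) by lra.
    assert (A1 : Rabs 1 = 1) by (apply Rabs_pos_eq; lra).
    assert (A2 : Rabs (-1) = 1) by (rewrite Rabs_left; lra).
    unfold T. destruct excluded_middle_informative as [Hc|Hc].
    - pose proof (proj1 Hst _ Hc) as Hm. apply (lift_morse f F _ HF) in Hm.
      destruct Hm as [M0 M2].
      change (Derive_n F 2 (a j)) with (Derive (Derive F) (a j)) in M2.
      pose proof (Derive_correct _ _ (Hex2 (a j))) as Hd.
      pose proof (sign_derive_limit _ _ _ _ _ _ Hd M0 L1 A1 R1) as S1.
      pose proof (sign_derive_limit _ _ _ _ _ _ Hd M0 L2 A2 R2) as S2.
      simpl flip. destruct E1 as [E1|E1], E2 as [E2|E2]; rewrite E1, E2 in *; try lia; exfalso; nra.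
    - rewrite Hsing in Hc.
      pose proof (sign_limit _ _ _ _ _ (HDc (a j)) L1 A1 R1) as S1.
      pose proof (sign_limit _ _ _ _ _ (HDc (a j)) L2 A2 R2) as S2.
      simpl flip. destruct E1 as [E1|E1], E2 as [E2|E2]; rewrite E1, E2 in *; try lia; exfalso; nra. }
  set (n := Z.of_nat (count_s w)). set (N := length w).
  assert (HN : N = length l) by (unfold N; now rewrite Hw, length_map).
  assert (Hvper : forall j k, v (j + k * n)%Z = v j + 2 * PI * IZR k).
  { intros j k. unfold n. rewrite <- Hvn. now apply periodic_enum_period. }
  destruct (lift_degree f F HF) as [D HD].
  assert (Hper : forall j, h (j + Z.of_nat N)%Z = (h j + D * n)%Z).
  { intros j. apply Hvinj. rewrite <- Hh, Hvper, <- Hh, <- HD. f_equal.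
    rewrite HN. unfold a. rewrite <- (Z.mul_1_l (Z.of_nat _)).
    rewrite periodic_enum_period by easy. ring. }
  assert (Hnth : forall k, (k < N)%nat -> T f (a (Z.of_nat k)) = nth k w sym_p).
  { intros k Hk. unfold a. rewrite periodic_enum_nth by lia.
    rewrite Hw, (nth_indep _ sym_p (T f 0)), map_nth by (rewrite length_map; lia).
    reflexivity. }
  pose proof (walk_along_word w h e Hstep
    (fun k Hk => eq_trans (Hflip _)
       (f_equal (fun x => flip x * e (Z.of_nat k - 1))%Z (Hnth k Hk)))) as Hwalk.
  assert (He1 : (e (-1) = 1 \/ e (-1) = -1)%Z) by apply He.
  destruct (Hwalk N ltac:(easy)) as [WE WH].
  unfold N in WE at 2, WH at 2. rewrite firstn_all in WE, WH.
  split; [|split].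
  - assert (E : e (Z.of_nat N - 1)%Z = e (-1)%Z).
    { pose proof (Hstep (-1)%Z) as X1. pose proof (Hstep (-1 + Z.of_nat N)%Z) as X2.
      pose proof (Hper (-1)%Z) as X3. pose proof (Hper (-1 + 1)%Z) as X4.
      replace (-1 + 1 + Z.of_nat N)%Z with (-1 + Z.of_nat N + 1)%Z in X4 by lia.
      replace (Z.of_nat N - 1)%Z with (-1 + Z.of_nat N)%Z by lia. lia. }
    destruct He1 as [E1|E1]; rewrite E1 in *; lia.
  - pose proof (Hper (-1)%Z) as X.
    replace (-1 + Z.of_nat N)%Z with (Z.of_nat N - 1)%Z in X by lia.
    exists (e (-1) * D)%Z. fold n.
    destruct He1 as [E1|E1]; rewrite E1 in *; lia.
  - intros r.
    (* The walk relative to its origin is [h] shifted and possibly negated, so the residue [r] is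
       attained where [h] has the residue of [R0]. *)
    set (R0 := (h (-1) + e (-1) * r)%Z).
    assert (HR : Delta f (P (v R0))) by (apply Hval; now exists R0).
    destruct HR as [q [Hq Eq]].
    destruct (P_surjective q) as [t [Ht <-]].
    assert (Hin : In t l) by (apply Hl; split; [easy|]; now exists (P t)).
    apply (In_nth _ _ 0) in Hin. destruct Hin as [k [Hk Ek]].
    assert (Hak : a (Z.of_nat k) = t) by (unfold a; now rewrite periodic_enum_nth).
    rewrite (proj1 HF), <- Hak, Hh in Eq. apply P_eq in Eq. destruct Eq as [m Em].
    rewrite <- Hvper in Em. apply Hvinj in Em.
    destruct (Hwalk (S k) ltac:(lia)) as [_ WK].
    replace (Z.of_nat (S k) - 1)%Z with (Z.of_nat k) in WK by lia.
    assert (Hks : nth k w sym_p = sym_s).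
    { rewrite <- Hnth by lia. apply T_singular. now rewrite Hak. }
    rewrite (firstn_succ_nth w k sym_p), Hks in WK by lia.
    exists (firstn k w), (skipn (S k) w). split.
    + rewrite <- (firstn_skipn (S k) w) at 1.
      rewrite (firstn_succ_nth w k sym_p), Hks, <- app_assoc by lia. reflexivity.
    + exists (e (-1) * m)%Z. fold n. unfold R0 in Em.
      rewrite Em in WK. clear - WK He1.
      destruct He1 as [E1|E1]; rewrite E1 in *; lia.
Qed.

(** * Smooth functions with flat pieces *)

(** With [k = 0] this is the standard smooth function vanishing on a half-line. The powers of [/ x] are
    included to make the family closed under differentiation. *)
Definition flat (k : nat) (x : R) : R :=
  if Rlt_dec 0 x then (/ x) ^ k * exp (- / x) else 0.

Lemma flat_pos (k : nat) (x : R) : 0 < x -> 0 < flat k x.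
Proof.
  intros Hx. unfold flat. destruct Rlt_dec; [|easy].
  apply Rmult_lt_0_compat; [|apply exp_pos].
  now apply pow_lt, Rinv_0_lt_compat.
Qed.

Lemma flat_npos (k : nat) (x : R) : x <= 0 -> flat k x = 0.
Proof. intros Hx. unfold flat. destruct Rlt_dec; lra. Qed.

Lemma pow_le_exp (m : nat) (y : R) :
  0 <= y -> y ^ m <= (INR m) ^ m * exp y.
Proof.
  intros Hy. destruct m as [|m].
  - simpl. pose proof (exp_ineq1_le y). lra.
  - set (M := INR (S m)). assert (HM : 0 < M) by apply lt_0_INR, Nat.lt_0_succ.
    assert (He : forall k z, exp (INR k * z) = exp z ^ k).
    { intros k z. induction k as [|k IH]; [simpl; rewrite Rmult_0_l; apply exp_0|].
      rewrite S_INR, Rmult_plus_distr_r, exp_plus, IH, Rmult_1_l. simpl. ring. }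
    assert (Ey : exp y = exp (y / M) ^ S m).
    { rewrite <- He. fold M. f_equal. field. lra. }
    replace y with (M * (y / M)) at 1 by (field; lra).
    rewrite Ey, Rpow_mult_distr.
    apply Rmult_le_compat_l; [apply pow_le; lra|].
    apply pow_incr. split.
    + apply Rmult_le_pos; [easy|]. left. now apply Rinv_0_lt_compat.
    + pose proof (exp_ineq1_le (y / M)). lra.
Qed.

(** The exponential beats every power of [/ x], so the difference quotient at the origin, which
    is again of the same family, tends to zero. *)
Lemma is_derive_flat (k : nat) (x : R) :
  is_derive (flat k) x (flat (k + 2) x - INR k * flat (k + 1) x).
Proof.
  destruct (Rtotal_order x 0) as [Hx|[Hx|Hx]].
  - rewrite !flat_npos by lra.
    apply (is_derive_ext_loc (fun _ => 0)).
    + exists (mkposreal (- x) ltac:(lra)). intros y Hy.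
      unfold ball in Hy. simpl in Hy. unfold AbsRing_ball, abs, minus, plus, opp in Hy.
      simpl in Hy. apply Rabs_def2 in Hy. rewrite flat_npos; [easy|lra].
    + replace (0 - INR k * 0) with 0 by ring. apply (is_derive_const 0 x).
  - subst x. rewrite !flat_npos by lra. replace (0 - INR k * 0) with 0 by ring.
    apply is_derive_Reals. intros eps Heps.
    set (C := INR (k + 2) ^ (k + 2)).
    assert (HC : 0 <= C) by (apply pow_le, pos_INR).
    assert (Hd : 0 < eps / (C + 1)) by (apply Rdiv_lt_0_compat; lra).
    exists (mkposreal _ Hd). intros h Hh0 Hh. simpl in Hh.
    rewrite Rplus_0_l, (flat_npos k 0), !Rminus_0_r by lra.
    destruct (Rle_or_lt h 0) as [Hle|Hpos].
    + rewrite flat_npos by easy. unfold Rdiv. rewrite Rmult_0_l, Rabs_R0. lra.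
    + rewrite Rabs_pos_eq in Hh by lra.
      assert (Hi : 0 < / h) by now apply Rinv_0_lt_compat.
      assert (E : flat k h / h = (/ h) ^ (k + 2) * exp (- / h) * h).
      { unfold flat. destruct Rlt_dec; [|easy]. rewrite pow_add. simpl. field. lra. }
      rewrite E.
      pose proof (pow_le_exp (k + 2) (/ h) ltac:(lra)) as Hp. fold C in Hp.
      pose proof (exp_pos (- / h)) as He.
      assert (Hb : (/ h) ^ (k + 2) * exp (- / h) <= C).
      { replace C with (C * exp (/ h) * exp (- / h)).
        - apply Rmult_le_compat_r; lra.
        - rewrite Rmult_assoc, <- exp_plus, Rplus_opp_r, exp_0. ring. }
      assert (Hb0 : 0 <= (/ h) ^ (k + 2) * exp (- / h)).
      { apply Rmult_le_pos; [apply pow_le|]; lra. }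
      rewrite Rabs_pos_eq by (apply Rmult_le_pos; lra).
      apply Rle_lt_trans with ((C + 1) * h).
      * apply Rmult_le_compat_r; lra.
      * apply (Rmult_lt_compat_l (C + 1)) in Hh; [|lra].
        replace ((C + 1) * (eps / (C + 1))) with eps in Hh by (field; lra). easy.
  - apply (is_derive_ext_loc (fun y => (/ y) ^ k * exp (- / y))).
    + exists (mkposreal x Hx). intros y Hy.
      unfold ball in Hy. simpl in Hy. unfold AbsRing_ball, abs, minus, plus, opp in Hy.
      simpl in Hy. apply Rabs_def2 in Hy. unfold flat.
      destruct Rlt_dec; [easy|lra].
    + unfold flat. destruct Rlt_dec; [|easy].
      auto_derive; [repeat split; lra|].
      destruct k as [|k].
      * simpl. field. lra.
      * rewrite !pow_add. cbn [pred]. rewrite <- tech_pow_Rmult. simpl (_ ^ 2). simpl (_ ^ 1).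
        field. lra.
Qed.

(** A syntax closed under formal differentiation: smoothness to all orders then follows from first
    derivatives alone. *)
Inductive term : Type :=
| TLin (a b : R)
| TSin (u : term)
| TCos (u : term)
| TFlat (k : nat) (u : term)
| TPlus (u v : term)
| TMult (u v : term).

Fixpoint eval (u : term) (t : R) : R :=
  match u with
  | TLin a b => a * t + b
  | TSin u => sin (eval u t)
  | TCos u => cos (eval u t)
  | TFlat k u => flat k (eval u t)
  | TPlus u v => eval u t + eval v t
  | TMult u v => eval u t * eval v t
  end.

Definition TConst (b : R) : term := TLin 0 b.

Fixpoint diff (u : term) : term :=
  match u with
  | TLin a b => TConst a
  | TSin u => TMult (diff u) (TCos u)
  | TCos u => TMult (diff u) (TMult (TConst (-1)) (TSin u))
  | TFlat k u =>
      TMult (diff u)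
        (TPlus (TFlat (k + 2) u) (TMult (TConst (- INR k)) (TFlat (k + 1) u)))
  | TPlus u v => TPlus (diff u) (diff v)
  | TMult u v => TPlus (TMult (diff u) v) (TMult u (diff v))
  end.

Lemma is_derive_eval (u : term) (t : R) : is_derive (eval u) t (eval (diff u) t).
Proof.
  induction u as [a b|u IH|u IH|k u IH|u IHu v IHv|u IHu v IHv]; cbn [eval diff TConst].
  - auto_derive; [easy|]. ring.
  - apply (is_derive_comp sin (eval u)); [apply is_derive_Reals, derivable_pt_lim_sin|easy].
  - replace (0 * t + -1) with (-1) by ring.
    replace (-1 * sin (eval u t)) with (- sin (eval u t)) by ring.
    apply (is_derive_comp cos (eval u)); [apply is_derive_Reals, derivable_pt_lim_cos|easy].
  - replace (0 * t + - INR k) with (- INR k) by ring.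
    replace (flat (k + 2) (eval u t) + - INR k * flat (k + 1) (eval u t))
      with (flat (k + 2) (eval u t) - INR k * flat (k + 1) (eval u t)) by ring.
    apply (is_derive_comp (flat k) (eval u)); [apply is_derive_flat|easy].
  - now apply (is_derive_plus (eval u) (eval v)).
  - apply (is_derive_mult (eval u) (eval v)); [easy|easy|].
    intros x y. apply Rmult_comm.
Qed.

Lemma continuous_eval (u : term) (t : R) : continuous (eval u) t.
Proof. apply (ex_derive_continuous (eval u)). eexists. apply is_derive_eval. Qed.

Lemma ex_derive_n_eval (u : term) (k : nat) (t : R) : ex_derive_n (eval u) k t.
Proof.
  destruct k as [|k]; [exact I|].
  apply (ex_derive_ext (eval (Nat.iter k diff u))).
  - clear t. induction k as [|k IH]; intros t; [easy|].
    simpl. symmetry.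
    rewrite (Derive_ext _ _ t (fun s => eq_sym (IH s))).
    apply is_derive_unique, is_derive_eval.
  - eexists. apply is_derive_eval.
Qed.

Lemma ex_RInt_eval (u : term) (x y : R) : ex_RInt (eval u) x y.
Proof. apply (ex_RInt_continuous (eval u)). intros z _. apply continuous_eval. Qed.

Lemma is_derive_RInt_eval (u : term) (y0 t : R) :
  is_derive (fun t => y0 + RInt (eval u) 0 t) t (eval u t).
Proof.
  replace (eval u t) with (0 + eval u t) by ring.
  apply (is_derive_plus (fun _ => y0)); [apply (is_derive_const y0)|].
  apply (is_derive_RInt (eval u) (RInt (eval u) 0) 0 t); [|apply continuous_eval].
  apply filter_forall. intros b. apply (RInt_correct (eval u)), ex_RInt_eval.
Qed.

(** * A derivative with prescribed simple zeros and edge integrals *)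

Definition node (N k : nat) : R := 2 * PI * INR k / INR N.

Lemma node_lt (N i j : nat) : (0 < N)%nat -> (i < j)%nat -> node N i < node N j.
Proof.
  intros HN Hij. unfold node. apply lt_INR in Hij. apply lt_0_INR in HN.
  pose proof PI_RGT_0. apply Rmult_lt_compat_r; [now apply Rinv_0_lt_compat|].
  apply Rmult_lt_compat_l; lra.
Qed.

Lemma node_le (N i j : nat) : (0 < N)%nat -> (i <= j)%nat -> node N i <= node N j.
Proof.
  intros HN Hij. destruct (Nat.eq_dec i j) as [->|E]; [lra|].
  left. apply node_lt; lia.
Qed.

Lemma node_0 (N : nat) : node N 0 = 0.
Proof. unfold node, Rdiv. simpl. ring. Qed.

Lemma node_full (N : nat) : (0 < N)%nat -> node N N = 2 * PI.
Proof. intros HN. apply lt_0_INR in HN. unfold node. field. lra. Qed.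

Lemma node_succ (N j : nat) : (0 < N)%nat -> node N (S j) = node N j + 2 * PI / INR N.
Proof. intros HN. apply lt_0_INR in HN. unfold node. rewrite S_INR. field. lra. Qed.

Lemma node_bounds (N j : nat) : (j < N)%nat -> 0 <= node N j < 2 * PI.
Proof.
  intros Hj. split.
  - rewrite <- (node_0 N). apply node_le; lia.
  - rewrite <- (node_full N) by lia. apply node_lt; lia.
Qed.

Lemma node_edge (N : nat) (t : R) :
  (0 < N)%nat -> 0 <= t < 2 * PI ->
  exists j, (j < N)%nat /\ node N j <= t < node N (S j).
Proof.
  intros HN [H0 H1]. rewrite <- (node_full N HN) in H1.
  assert (G : forall m, (m <= N)%nat -> t < node N m ->
    exists j, (j < N)%nat /\ node N j <= t < node N (S j)).
  { induction m as [|m IH]; intros Hm Ht.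
    - rewrite node_0 in Ht. lra.
    - destruct (Rlt_or_le t (node N m)) as [Hlt|Hle]; [apply IH; [lia|easy]|].
      exists m. split; [lia|easy]. }
  now apply (G N).
Qed.

(** A half-angle sine has one zero per period, a simple one, and changes sign under a full turn. The
    order in the difference makes the product positive before the first zero, as [turn] is; [k0] is
    the position of the first letter, shifted in the recursion. *)
Fixpoint zeros (N k0 : nat) (w : list symbol) : term :=
  match w with
  | [] => TConst 1
  | sym_s :: w' => TMult (TSin (TLin (- / 2) (node N k0 / 2))) (zeros N (S k0) w')
  | sym_p :: w' => zeros N (S k0) w'
  end.

Lemma eval_const (b t : R) : eval (TConst b) t = b.
Proof. simpl. ring. Qed.

Lemma eval_zeros_s (N k0 : nat) (w : list symbol) (t : R) :
  eval (zeros N k0 (sym_s :: w)) t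
  = sin ((node N k0 - t) / 2) * eval (zeros N (S k0) w) t.
Proof. cbn [zeros eval]. do 2 f_equal. field. Qed.

Lemma zeros_bound (N k0 : nat) (w : list symbol) (t : R) :
  Rabs (eval (zeros N k0 w) t) <= 1.
Proof.
  revert k0. induction w as [|[] w IH]; intros k0.
  - cbn [zeros]. rewrite eval_const, Rabs_R1. lra.
  - rewrite eval_zeros_s, Rabs_mult. rewrite <- (Rmult_1_l 1).
    apply Rmult_le_compat; try apply Rabs_pos; [|apply IH].
    apply Rabs_le, SIN_bound.
  - apply IH.
Qed.

Lemma zeros_period (N k0 : nat) (w : list symbol) (t : R) :
  eval (zeros N k0 w) (t + 2 * PI) = IZR (turn w) * eval (zeros N k0 w) t.
Proof.
  revert k0. induction w as [|[] w IH]; intros k0.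
  - cbn [zeros turn]. rewrite !eval_const. ring.
  - rewrite !eval_zeros_s, IH. cbn [turn flip]. rewrite mult_IZR.
    replace ((node N k0 - (t + 2 * PI)) / 2) with ((node N k0 - t) / 2 - PI) by field.
    rewrite sin_minus, cos_PI, sin_PI. ring.
  - cbn [turn flip zeros]. rewrite IH, mult_IZR. ring.
Qed.

Lemma sin_half_pos (x : R) : 0 < x < 2 * PI -> 0 < sin (x / 2).
Proof. intros H. apply sin_gt_0; lra. Qed.

Lemma sin_half_neg (x : R) : - (2 * PI) < x < 0 -> sin (x / 2) < 0.
Proof.
  intros H. replace (x / 2) with (- (- x / 2)) by field. rewrite sin_neg.
  pose proof (sin_half_pos (- x) ltac:(lra)). lra.
Qed.

(** On an edge, exactly the factors of the earlier nodes are negative. *)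
Lemma zeros_sign (N k0 j : nat) (w : list symbol) (t : R) :
  (k0 + length w <= N)%nat -> (j < N)%nat -> node N j < t < node N (S j) ->
  0 < IZR (turn (firstn (S j - k0) w)) * eval (zeros N k0 w) t.
Proof.
  revert k0. induction w as [|x w IH]; intros k0 Hk Hj Ht.
  - rewrite firstn_nil. cbn [turn zeros]. rewrite eval_const. lra.
  - cbn [length] in Hk. specialize (IH (S k0) ltac:(lia) Hj Ht).
    assert (HN : (0 < N)%nat) by lia.
    destruct (node_bounds N k0 ltac:(lia)) as [Hb0 Hb1].
    destruct (node_bounds N j Hj) as [Hc0 Hc1].
    pose proof (node_le N (S j) N HN ltac:(lia)) as Hc2. rewrite node_full in Hc2 by easy.
    destruct (Nat.le_gt_cases k0 j) as [Hle|Hgt].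
    + replace (S j - k0)%nat with (S (S j - S k0)) by lia.
      cbn [firstn turn]. rewrite mult_IZR. destruct x; cbn [flip].
      * rewrite eval_zeros_s.
        pose proof (node_le N k0 j HN Hle).
        pose proof (sin_half_neg (node N k0 - t) ltac:(lra)). nra.
      * cbn [zeros]. lra.
    + replace (S j - S k0)%nat with 0%nat in IH by lia.
      replace (S j - k0)%nat with 0%nat by lia. cbn [firstn turn] in *.
      destruct x.
      * rewrite eval_zeros_s.
        pose proof (node_le N (S j) k0 HN Hgt).
        pose proof (sin_half_pos (node N k0 - t) ltac:(lra)). nra.
      * cbn [zeros]. lra.
Qed.

Lemma zeros_node_nonzero (N k0 j : nat) (w : list symbol) :
  (k0 + length w <= N)%nat -> (j < N)%nat ->
  (forall k, nth_error w k = Some sym_s -> (k0 + k)%nat <> j) ->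
  eval (zeros N k0 w) (node N j) <> 0.
Proof.
  revert k0. induction w as [|x w IH]; intros k0 Hk Hj Hw.
  - cbn [zeros]. rewrite eval_const. lra.
  - cbn [length] in Hk.
    assert (IH' : eval (zeros N (S k0) w) (node N j) <> 0).
    { apply IH; [lia|easy|]. intros k E. specialize (Hw (S k) E). lia. }
    destruct x; [|exact IH']. rewrite eval_zeros_s.
    apply Rmult_integral_contrapositive_currified; [|exact IH'].
    specialize (Hw 0%nat eq_refl).
    pose proof (node_bounds N k0 ltac:(lia)). pose proof (node_bounds N j Hj).
    destruct (Nat.lt_total k0 j) as [E|[E|E]]; [|lia|].
    + pose proof (node_lt N k0 j ltac:(lia) E).
      pose proof (sin_half_neg (node N k0 - node N j) ltac:(lra)). lra.
    + pose proof (node_lt N j k0 ltac:(lia) E).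
      pose proof (sin_half_pos (node N k0 - node N j) ltac:(lra)). lra.
Qed.

Lemma zeros_node_zero (N k0 k : nat) (w : list symbol) :
  nth_error w k = Some sym_s -> eval (zeros N k0 w) (node N (k0 + k)) = 0.
Proof.
  revert k0 k. induction w as [|x w IH]; intros k0 [|k] H; try discriminate.
  - injection H as ->. rewrite eval_zeros_s, Nat.add_0_r.
    replace ((node N k0 - node N k0) / 2) with 0 by field. rewrite sin_0. ring.
  - simpl in H. apply (IH (S k0)) in H.
    replace (k0 + S k)%nat with (S k0 + k)%nat by lia.
    destruct x; [rewrite eval_zeros_s|cbn [zeros]]; rewrite H; ring.
Qed.

(** At a zero only the term differentiating the vanishing factor survives. *)
Lemma zeros_node_simple (N k0 k : nat) (w : list symbol) :
  (k0 + length w <= N)%nat -> nth_error w k = Some sym_s ->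
  eval (diff (zeros N k0 w)) (node N (k0 + k)) <> 0.
Proof.
  revert k0 k. induction w as [|x w IH]; intros k0 k Hk H; [now destruct k|].
  cbn [length] in Hk.
  assert (HkN : (k < S (length w))%nat).
  { change (S (length w)) with (length (x :: w)). apply nth_error_Some. now rewrite H. }
  destruct k as [|k].
  - injection H as ->. rewrite Nat.add_0_r. cbn [zeros diff eval TConst].
    replace (- / 2 * node N k0 + node N k0 / 2) with 0 by field.
    rewrite sin_0, cos_0.
    match goal with |- ?l <> 0 =>
      replace l with (- / 2 * eval (zeros N (S k0) w) (node N k0)) by ring end.
    apply Rmult_integral_contrapositive_currified; [lra|].
    apply zeros_node_nonzero; [lia|lia|]. intros k _. lia.
  - simpl in H. replace (k0 + S k)%nat with (S k0 + k)%nat by lia.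
    destruct x; [|apply IH; [cbn [length] in Hk; lia|easy]].
    cbn [zeros diff eval].
    rewrite (zeros_node_zero N (S k0) k w H), Rmult_0_r, Rplus_0_l.
    apply Rmult_integral_contrapositive_currified; [|apply IH; [lia|easy]].
    replace (- / 2 * node N (S k0 + k) + node N k0 / 2)
      with ((node N k0 - node N (S k0 + k)) / 2) by field.
    pose proof (node_bounds N k0 ltac:(lia)).
    pose proof (node_bounds N (S k0 + k) ltac:(lia)).
    pose proof (node_lt N k0 (S k0 + k) ltac:(lia) ltac:(lia)).
    pose proof (sin_half_neg (node N k0 - node N (S k0 + k)) ltac:(lra)). lra.
Qed.

(** A cosine exceeds [cos (PI / N)] exactly within half an edge of the maximum, here put at the
    middle of the edge from node [j]; this gives periodicity for free. *)
Definition bump (N j : nat) : term :=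
  TFlat 0 (TPlus (TCos (TLin 1 (- (node N j + PI / INR N)))) (TConst (- cos (PI / INR N)))).

Lemma eval_bump (N j : nat) (t : R) :
  eval (bump N j) t = flat 0 (cos (t - (node N j + PI / INR N)) - cos (PI / INR N)).
Proof.
  cbn [bump eval TConst]. unfold Rminus. f_equal. rewrite Rmult_1_l. ring.
Qed.

Lemma bump_nonneg (N j : nat) (t : R) : 0 <= eval (bump N j) t.
Proof.
  rewrite eval_bump. set (x := _ - _). destruct (Rle_or_lt x 0) as [H|H].
  - rewrite flat_npos; lra.
  - left. now apply flat_pos.
Qed.

Lemma bump_period (N j : nat) (t : R) :
  eval (bump N j) (t + 2 * PI) = eval (bump N j) t.
Proof.
  rewrite !eval_bump. do 2 f_equal.
  replace (t + 2 * PI - (node N j + PI / INR N))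
    with ((t - (node N j + PI / INR N)) + 2 * INR 1 * PI) by (simpl; ring).
  apply cos_period.
Qed.

Lemma PI_div_bounds (N : nat) : (0 < N)%nat -> 0 < PI / INR N <= PI.
Proof.
  intros HN. pose proof PI_RGT_0. pose proof (le_INR 1 N HN) as H1. simpl in H1.
  split; [apply Rdiv_lt_0_compat; lra|].
  apply Rmult_le_reg_r with (INR N); [lra|].
  unfold Rdiv. rewrite Rmult_assoc, Rinv_l by lra. nra.
Qed.

Lemma bump_pos (N j : nat) (t : R) :
  (0 < N)%nat -> node N j < t < node N (S j) -> 0 < eval (bump N j) t.
Proof.
  intros HN Ht. rewrite node_succ in Ht by easy.
  pose proof (PI_div_bounds N HN). rewrite eval_bump. apply flat_pos.
  replace (2 * PI / INR N) with (2 * (PI / INR N)) in Ht by (field; apply not_0_INR; lia).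
  set (d := PI / INR N) in *. set (x := t - (node N j + d)).
  assert (Hx : - d < x < d) by (unfold x; lra).
  enough (cos d < cos x) by lra.
  destruct (Rle_or_lt 0 x).
  - apply cos_decreasing_1; lra.
  - rewrite <- (cos_neg x). apply cos_decreasing_1; lra.
Qed.

Lemma bump_zero (N i j : nat) (t : R) :
  (i < N)%nat -> (j < N)%nat -> i <> j -> node N i < t < node N (S i) ->
  eval (bump N j) t = 0.
Proof.
  intros Hi Hj Hij Ht. assert (HN : (0 < N)%nat) by lia.
  pose proof (PI_div_bounds N HN) as Hd. rewrite eval_bump. apply flat_npos.
  assert (E : 2 * PI / INR N = 2 * (PI / INR N)) by (field; apply not_0_INR; lia).
  pose proof (node_succ N j HN) as Hsj. rewrite E in Hsj.
  pose proof (node_bounds N i Hi). pose proof (node_bounds N j Hj).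
  pose proof (node_le N (S i) N HN ltac:(lia)) as Hb1.
  pose proof (node_le N (S j) N HN ltac:(lia)) as Hb2.
  rewrite node_full in Hb1, Hb2 by easy.
  set (d := PI / INR N) in *. set (x := t - (node N j + d)).
  assert (Hx : d <= Rabs x <= 2 * PI - d).
  { destruct (Nat.lt_total i j) as [L|[L|L]]; [|easy|].
    - pose proof (node_le N (S i) j HN L). rewrite Rabs_left; unfold x; lra.
    - pose proof (node_le N (S j) i HN L). rewrite Rabs_pos_eq; unfold x; lra. }
  assert (Hcos : cos x = cos (Rabs x)).
  { unfold Rabs. destruct Rcase_abs; [now rewrite cos_neg|easy]. }
  rewrite Hcos. enough (cos (Rabs x) <= cos d) by lra.
  destruct (Rle_or_lt (Rabs x) PI).
  - apply cos_decr_1; lra.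
  - replace (cos (Rabs x)) with (cos (2 * PI - Rabs x)).
    + apply cos_decr_1; lra.
    + rewrite cos_minus, cos_2PI, sin_2PI. ring.
Qed.

(** Adding a multiple of a positive function to a small constant weight tunes the integral of
    [u] to any prescribed value that is large enough. *)
Lemma weight_adjust (u v : term) (x y c e : R) :
  x < y -> e * e = 1 -> (y - x) / 2 < c ->
  (forall t, Rabs (eval u t) <= 1) ->
  (forall t, x < t < y -> 0 < e * eval u t) ->
  (forall t, x < t < y -> 0 < eval v t) ->
  exists lam, 0 <= lam /\
    RInt (fun t => eval u t * (/ 2 + lam * eval v t)) x y = e * c.
Proof.
  intros Hxy He Hc Hb Hu Hv.
  set (I0 := RInt (eval u) x y). set (I1 := RInt (eval (TMult u v)) x y).
  assert (HI0 : e * I0 <= y - x).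
  { unfold I0. rewrite <- (RInt_scal (eval u)) by apply ex_RInt_eval.
    replace (y - x) with (RInt (fun _ => 1) x y)
      by (rewrite RInt_const; apply Rmult_1_r).
    apply RInt_le; [lra| |apply ex_RInt_const|].
    - apply (ex_RInt_scal (eval u)), ex_RInt_eval.
    - intros t Ht. unfold scal; simpl; unfold mult; simpl.
      specialize (Hb t). apply Rabs_le_between in Hb.
      assert (e = 1 \/ e = -1) as [-> | ->] by (destruct (Rle_or_lt 0 e); [left|right]; nra); lra. }
  assert (HI1 : 0 < e * I1).
  { unfold I1. rewrite <- (RInt_scal (eval (TMult u v))) by apply ex_RInt_eval.
    apply RInt_gt_0; [easy| |].
    - intros t Ht. unfold scal; simpl; unfold mult; simpl.
      rewrite <- Rmult_assoc. apply Rmult_lt_0_compat; [now apply Hu|now apply Hv].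
    - intros t Ht. apply (continuous_scal_r e (eval (TMult u v))), continuous_eval. }
  exists ((c - / 2 * (e * I0)) / (e * I1)). split.
  - left. apply Rdiv_lt_0_compat; lra.
  - set (lam := _ / _).
    rewrite (RInt_ext _ (eval (TPlus (TMult (TConst (/ 2)) u)
      (TMult (TConst lam) (TMult u v))))).
    2:{ intros t _. cbn [eval TConst].
        match goal with |- ?a = ?b => change (@eq R a b) end. ring. }
    transitivity (/ 2 * I0 + lam * I1).
    + apply is_RInt_unique.
      apply (is_RInt_ext
        (fun t => plus (scal (/ 2) (eval u t)) (scal lam (eval (TMult u v) t)))).
      { intros t _. unfold scal, plus; simpl; unfold mult; simpl. ring. }
      apply (is_RInt_plus (fun t => scal (/ 2) (eval u t))
               (fun t => scal lam (eval (TMult u v) t)));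
        apply (is_RInt_scal (V := R_NormedModule));
        apply (RInt_correct (V := R_CompleteNormedModule)), ex_RInt_eval.
    + assert (Hlam : lam * (e * I1) = c - / 2 * (e * I0)).
      { unfold lam, Rdiv. rewrite Rmult_assoc, Rinv_l by lra. apply Rmult_1_r. }
      change (@eq R (/ 2 * I0 + lam * I1) (e * c)).
      transitivity (e * (/ 2 * (e * I0) + lam * (e * I1))).
      * replace (e * (/ 2 * (e * I0) + lam * (e * I1)))
          with (e * e * (/ 2 * I0 + lam * I1)) by ring.
        rewrite He. ring.
      * rewrite Hlam. ring.
Qed.

Fixpoint weight (N : nat) (lam : nat -> R) (M : nat) : term :=
  match M with
  | O => TConst (/ 2)
  | S m => TPlus (weight N lam m) (TMult (TConst (lam m)) (bump N m))
  end.

Lemma weight_succ (N : nat) (lam : nat -> R) (m : nat) (t : R) :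
  eval (weight N lam (S m)) t = eval (weight N lam m) t + lam m * eval (bump N m) t.
Proof. cbn [weight eval TConst]. ring. Qed.

Lemma weight_pos (N : nat) (lam : nat -> R) (M : nat) (t : R) :
  (forall j, 0 <= lam j) -> 0 < eval (weight N lam M) t.
Proof.
  intros Hl. induction M as [|m IH].
  - cbn [weight]. rewrite eval_const. lra.
  - rewrite weight_succ. pose proof (Rmult_le_pos _ _ (Hl m) (bump_nonneg N m t)). lra.
Qed.

Lemma weight_period (N : nat) (lam : nat -> R) (M : nat) (t : R) :
  eval (weight N lam M) (t + 2 * PI) = eval (weight N lam M) t.
Proof.
  induction M as [|m IH].
  - cbn [weight]. now rewrite !eval_const.
  - now rewrite !weight_succ, IH, bump_period.
Qed.

Lemma weight_edge (N : nat) (lam : nat -> R) (M i : nat) (t : R) :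
  (M <= N)%nat -> (i < N)%nat -> node N i < t < node N (S i) ->
  eval (weight N lam M) t
  = / 2 + (if (i <? M)%nat then lam i * eval (bump N i) t else 0).
Proof.
  intros HM Hi Ht. induction M as [|m IH].
  - cbn [weight]. rewrite eval_const. simpl. ring.
  - rewrite weight_succ, IH by lia.
    destruct (Nat.eq_dec i m) as [->|E].
    + rewrite Nat.ltb_irrefl. rewrite (proj2 (Nat.ltb_lt m (S m))) by lia. ring.
    + rewrite (bump_zero N i m t) by (auto; lia).
      destruct (Nat.ltb_spec i m), (Nat.ltb_spec i (S m)); try lia; ring.
Qed.

Lemma turn_sqr (w : list symbol) : IZR (turn w) * IZR (turn w) = 1.
Proof. destruct (turn_unit w) as [-> | ->]; lra. Qed.

Lemma count_s_le_length (w : list symbol) : (count_s w <= length w)%nat.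
Proof. apply filter_length_le. Qed.

(** The zeros and signs come from [zeros], the edge integrals from the weight. The constant part of the
    weight contributes at most half the length of an edge, which is less than the target since there
    are at most as many singular letters as letters. *)
Lemma derivative_with_turns (w : list symbol) :
  turn w = 1%Z -> (1 <= count_s w)%nat ->
  let N := length w in
  exists u : term,
    (forall t, eval u (t + 2 * PI) = eval u t) /\
    (forall j, (j < N)%nat ->
       RInt (eval u) (node N j) (node N (S j))
       = IZR (turn (firstn (S j) w)) * (2 * PI / INR (count_s w))) /\
    (forall j t, (j < N)%nat -> node N j < t < node N (S j) ->
       0 < IZR (turn (firstn (S j) w)) * eval u t) /\
    (forall j, nth_error w j = Some sym_s ->
       eval u (node N j) = 0 /\ eval (diff u) (node N j) <> 0) /\
    (forall j, nth_error w j = Some sym_p -> eval u (node N j) <> 0).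
Proof.
  intros Ht Hn N.
  pose proof (count_s_le_length w) as HnN. fold N in HnN.
  assert (HN : (0 < N)%nat) by lia.
  set (z := zeros N 0 w).
  assert (Hsgn : forall j t, (j < N)%nat -> node N j < t < node N (S j) ->
            0 < IZR (turn (firstn (S j) w)) * eval z t).
  { intros j t Hj Hjt. apply (zeros_sign N 0 j w t); [unfold N; lia|easy|easy]. }
  assert (Hlam : forall j, exists lam, 0 <= lam /\ ((j < N)%nat ->
    RInt (fun t => eval z t * (/ 2 + lam * eval (bump N j) t)) (node N j) (node N (S j))
    = IZR (turn (firstn (S j) w)) * (2 * PI / INR (count_s w)))).
  { intros j. destruct (Nat.lt_ge_cases j N) as [Hj|Hj];
      [|exists 0; split; [lra|intros; lia]].
    destruct (weight_adjust z (bump N j) (node N j) (node N (S j))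
      (2 * PI / INR (count_s w)) (IZR (turn (firstn (S j) w)))) as [lam [H0 H1]].
    - apply node_lt; lia.
    - apply turn_sqr.
    - rewrite node_succ by easy.
      assert (H1 : / INR N <= / INR (count_s w)).
      { apply Rinv_le_contravar; [apply lt_0_INR; lia|now apply le_INR]. }
      assert (0 < / INR N) by (apply Rinv_0_lt_compat, lt_0_INR; lia).
      pose proof PI_RGT_0. unfold Rdiv. nra.
    - intros t. apply zeros_bound.
    - intros t Hjt. now apply Hsgn.
    - intros t Hjt. now apply bump_pos.
    - exists lam. now split. }
  destruct (functional_choice _ Hlam) as [lam Hl].
  assert (Hpos : forall t, 0 < eval (weight N lam N) t).
  { intros t. apply weight_pos. intros j. apply Hl. }
  exists (TMult z (weight N lam N)).
  split; [|split; [|split; [|split]]].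
  - intros t. cbn [eval]. unfold z. rewrite weight_period, zeros_period, Ht. ring.
  - intros j Hj. rewrite <- (proj2 (Hl j) Hj). apply RInt_ext.
    intros t Hjt. pose proof (node_lt N j (S j) HN ltac:(lia)).
    rewrite Rmin_left, Rmax_right in Hjt by lra.
    cbn [eval]. rewrite (weight_edge N lam N j t) by (auto; lia).
    now rewrite (proj2 (Nat.ltb_lt j N) Hj).
  - intros j t Hj Hjt. cbn [eval]. rewrite <- Rmult_assoc.
    apply Rmult_lt_0_compat; [now apply Hsgn|apply Hpos].
  - intros j Hj.
    pose proof (zeros_node_zero N 0 j w Hj) as E. fold z in E. rewrite Nat.add_0_l in E.
    cbn [eval diff]. rewrite E. split; [ring|].
    rewrite Rmult_0_l, Rplus_0_r. apply Rmult_integral_contrapositive_currified.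
    + apply (zeros_node_simple N 0 j w); [unfold N; lia|easy].
    + specialize (Hpos (node N j)). lra.
  - intros j Hj. cbn [eval]. apply Rmult_integral_contrapositive_currified.
    + apply zeros_node_nonzero; [unfold N; lia| |].
      * apply nth_error_Some. now rewrite Hj.
      * intros k Hk E. simpl in E. subst. congruence.
    + specialize (Hpos (node N j)). lra.
Qed.

(** * Realizing a balanced word *)

Lemma translation_iterate (F : R -> R) (D : Z) :
  (forall t, F (t + 2 * PI) = F t + 2 * PI * IZR D) ->
  forall k t, F (t + 2 * PI * IZR k) = F t + 2 * PI * IZR (k * D).
Proof.
  intros H.
  assert (G : forall n t, F (t + 2 * PI * INR n) = F t + 2 * PI * INR n * IZR D).
  { intros n. induction n as [|n IH]; intros t.
    - simpl. rewrite !Rmult_0_r, Rmult_0_l, !Rplus_0_r. reflexivity.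
    - rewrite S_INR.
      replace (t + 2 * PI * (INR n + 1)) with ((t + 2 * PI * INR n) + 2 * PI) by ring.
      rewrite H, IH. ring. }
  intros k t. rewrite mult_IZR. destruct (Z_le_gt_dec 0 k) as [Hk|Hk].
  - specialize (G (Z.to_nat k) t). rewrite INR_IZR_INZ, Z2Nat.id in G by easy.
    rewrite G. ring.
  - specialize (G (Z.to_nat (- k)) (t + 2 * PI * IZR k)).
    rewrite INR_IZR_INZ, Z2Nat.id, opp_IZR in G by lia.
    replace (t + 2 * PI * IZR k + 2 * PI * - IZR k) with t in G by ring. lra.
Qed.

Definition descend (F : R -> R) (q : circle) : circle := P (F (angle q)).

Lemma descend_lift (F : R -> R) (D : Z) :
  (forall t, F (t + 2 * PI) = F t + 2 * PI * IZR D) ->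
  (forall k t, ex_derive_n F k t) -> lift (descend F) F.
Proof.
  intros HD HF. split; [|exact HF]. intros t. unfold descend.
  destruct (angle_spec (P t)) as [_ E]. apply P_eq in E. destruct E as [k ->].
  rewrite (translation_iterate F D HD). apply P_add_period.
Qed.

Lemma in_marks (w : list symbol) (k0 k : nat) :
  In k (marks k0 w) <-> (k0 <= k)%nat /\ nth_error w (k - k0) = Some sym_s.
Proof.
  revert k0. induction w as [|x w IH]; intros k0.
  - simpl. rewrite nth_error_nil. split; [easy|]. now intros [_ H].
  - assert (G : forall y, (k0 < k)%nat -> nth_error (y :: w) (k - k0) = nth_error w (k - S k0)).
    { intros y Hk. now replace (k - k0)%nat with (S (k - S k0)) by lia. }
    destruct (Nat.lt_total k k0) as [L|[L|L]].
    + destruct x; simpl; rewrite IH; lia.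
    + subst. rewrite Nat.sub_diag. destruct x; simpl; rewrite IH.
      * split; [now split|now left].
      * split; [lia|]. now intros [_ H].
    + rewrite G by easy. destruct x; simpl; rewrite IH; split; intros H.
      * destruct H as [H|H]; [lia|]. split; [lia|easy].
      * right. split; [lia|easy].
      * split; [lia|easy].
      * split; [lia|easy].
Qed.

Lemma length_marks (w : list symbol) (k0 : nat) : length (marks k0 w) = count_s w.
Proof.
  revert k0. induction w as [|[] w IH]; intros k0; [easy| |].
  - unfold count_s. simpl. f_equal. apply IH.
  - apply IH.
Qed.

Lemma NoDup_map_injective {X Y : Type} (g : X -> Y) (l : list X) (x y : X) :
  NoDup (map g l) -> In x l -> In y l -> g x = g y -> x = y.
Proof.
  induction l as [|z l IH]; intros Hn Hx Hy E; [easy|].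
  inversion_clear Hn as [|? ? Hz Hl].
  destruct Hx as [->|Hx], Hy as [->|Hy]; [easy| | |now apply IH].
  - exfalso. apply Hz. rewrite E. now apply in_map.
  - exfalso. apply Hz. rewrite <- E. now apply in_map.
Qed.

(** As many singular letters as residues, and every residue attained: each only once. *)
Lemma balanced_residues_distinct (w : list symbol) (i j : nat) :
  (1 <= count_s w)%nat -> balanced w ->
  nth_error w i = Some sym_s -> nth_error w j = Some sym_s ->
  (Z.of_nat (count_s w) | height (firstn (S i) w) - height (firstn (S j) w))%Z -> i = j.
Proof.
  intros Hn [_ [_ Hc]] Hi Hj Hd. set (n := Z.of_nat (count_s w)) in *.
  set (g := fun k => (height (firstn (S k) w) mod n)%Z).
  assert (Hnd : NoDup (map g (marks 0 w))).
  { apply (NoDup_incl_NoDup (l := map Z.of_nat (seq 0 (count_s w)))).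
    - apply FinFun.Injective_map_NoDup; [|apply seq_NoDup].
      intros x y E. lia.
    - rewrite !length_map, length_seq, length_marks. easy.
    - intros r Hr. apply in_map_iff in Hr. destruct Hr as [r' [<- Hr]].
      apply in_seq in Hr. destruct (Hc (Z.of_nat r')) as [u [v [Hw [q Hq]]]].
      apply in_map_iff. exists (length u). split.
      + unfold g. rewrite Hw.
        replace (S (length u)) with (length (u ++ [sym_s]))
          by (rewrite length_app; simpl; lia).
        replace (u ++ sym_s :: v) with ((u ++ [sym_s]) ++ v)
          by (now rewrite <- app_assoc).
        rewrite firstn_app, Nat.sub_diag, firstn_all, firstn_O, app_nil_r.
        replace (height (u ++ [sym_s])) with (Z.of_nat r' + q * n)%Z by lia.
        rewrite Z_mod_plus_full. apply Z.mod_small. lia.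
      + apply in_marks. split; [lia|].
        rewrite Hw, Nat.sub_0_r, nth_error_app2, Nat.sub_diag by lia. easy. }
  apply (NoDup_map_injective g (marks 0 w)); [easy| | |].
  - apply in_marks. rewrite Nat.sub_0_r. split; [lia|easy].
  - apply in_marks. rewrite Nat.sub_0_r. split; [lia|easy].
  - unfold g. destruct Hd as [q Hq].
    replace (height (firstn (S i) w)) with (height (firstn (S j) w) + q * n)%Z by lia.
    apply Z_mod_plus_full.
Qed.

(** The antiderivative starts at [2 * PI / n] because the walk makes its first step before the first
    letter. *)
Lemma balanced_word_realized (w : list symbol) :
  balanced w -> (1 <= count_s w)%nat ->
  exists f, smooth f /\ stable f /\ is_Ast f w.
Proof.
  intros Hbal Hn. pose proof Hbal as [Ht [[D HD] Hc]].
  destruct (derivative_with_turns w Ht Hn) as [u [Hper [Hint [Hsgn [Hs Hp]]]]].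
  pose proof (count_s_le_length w) as HnN.
  set (N := length w) in *. set (n := count_s w) in *.
  assert (HN : (0 < N)%nat) by lia.
  assert (Hn0 : 0 < INR n) by (apply lt_0_INR; lia).
  pose proof PI_RGT_0 as HPI.
  set (c := 2 * PI / INR n). assert (Hc0 : 0 < c) by (apply Rdiv_lt_0_compat; lra).
  (* The position of the walk at node [j]: the step leading to the node has been made, its letter has
     not been read. *)
  set (g := fun j => (height (firstn j w) + turn (firstn j w))%Z).
  assert (Hg : forall j, (j < N)%nat -> g j = height (firstn (S j) w)).
  { intros j Hj. unfold g. rewrite (firstn_succ_nth w j sym_p), height_app by easy.
    destruct (nth j w sym_p); cbn [height flip]; lia. }
  assert (Hgs : forall j, (j < N)%nat -> g (S j) = (g j + turn (firstn (S j) w))%Z).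
  { intros j Hj. rewrite (Hg j Hj). reflexivity. }
  set (F := fun t => c + RInt (eval u) 0 t).
  assert (DF : forall t, is_derive F t (eval u t)) by (intros t; apply is_derive_RInt_eval).
  assert (EF : forall t, Derive F t = eval u t) by (intros t; apply is_derive_unique, DF).
  assert (Hex : forall t : R, ex_derive F t) by (intros t; eexists; apply DF).
  assert (HFn : forall j, (j <= N)%nat -> F (node N j) = c * IZR (g j)).
  { induction j as [|j IH]; intros Hj.
    - unfold F, g. rewrite node_0, RInt_point. unfold zero. simpl. ring.
    - rewrite Hgs by lia. rewrite plus_IZR, Rmult_plus_distr_l, <- IH by lia.
      unfold F. rewrite <- (RInt_Chasles (eval u) 0 (node N j)) by apply ex_RInt_eval.
      rewrite Hint by lia. unfold plus; simpl. fold c. ring. }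
  assert (HFD : forall t, F (t + 2 * PI) = F t + 2 * PI * IZR D).
  { intros t.
    assert (E : F (t + 2 * PI) - F t = F (0 + 2 * PI) - F 0).
    { apply (constant_of_derive_zero (fun t => F (t + 2 * PI) - F t)).
      intros s. auto_derive; [split; [apply Hex|split; [apply Hex|easy]]|].
      change (Derive (fun x => F x) (s + 2 * PI)) with (Derive F (s + 2 * PI)).
      change (Derive (fun x => F x) s) with (Derive F s).
      rewrite !EF, Hper. ring. }
    assert (E0 : F 0 = c).
    { rewrite <- (node_0 N), HFn by lia. unfold g. simpl. ring. }
    assert (E1 : F (2 * PI) = c * IZR (D * Z.of_nat n + 1)).
    { rewrite <- (node_full N HN), HFn by lia. unfold g, N.
      now rewrite firstn_all, Ht, HD. }
    rewrite Rplus_0_l, E0, E1, plus_IZR, mult_IZR, <- INR_IZR_INZ in E.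
    assert (Ec : c * INR n = 2 * PI) by (unfold c; field; lra).
    rewrite <- Ec at 2. simpl IZR in E. lra. }
  assert (HFs : forall k t, ex_derive_n F k t).
  { intros [|k] t; [exact I|]. apply ex_derive_n_Derive; [easy|].
    apply (ex_derive_n_ext (eval u)); [intros s; now rewrite EF|]. apply ex_derive_n_eval. }
  set (f := descend F).
  assert (HL : lift f F) by now apply (descend_lift F D).
  assert (Hletter : forall j, (j < N)%nat ->
            nth_error w j = Some sym_s \/ nth_error w j = Some sym_p).
  { intros j Hj. destruct (nth_error w j) as [[]|] eqn:E; [now left|now right|].
    apply nth_error_None in E. fold N in E. lia. }
  assert (Hnode : forall j, (j < N)%nat ->
            singular f (P (node N j)) <-> nth_error w j = Some sym_s).
  { intros j Hj. rewrite (lift_singular f F _ HL), EF. split.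
    - intros E. destruct (Hletter j Hj) as [|E']; [easy|]. now apply Hp in E'.
    - intros E. now apply Hs. }
  assert (Hsing : forall q, singular f q -> exists j, (j < N)%nat /\ q = P (node N j)).
  { intros q Hq. destruct (P_surjective q) as [t [Hb <-]].
    destruct (node_edge N t HN Hb) as [j [Hj [Hle Hlt]]]. exists j. split; [easy|].
    destruct Hle as [Hlt'|<-]; [|easy].
    apply (lift_singular f F _ HL) in Hq. rewrite EF in Hq.
    specialize (Hsgn j t Hj (conj Hlt' Hlt)). rewrite Hq in Hsgn. lra. }
  assert (HPm : forall m k : Z, P (c * IZR (m + k * Z.of_nat n)) = P (c * IZR m)).
  { intros m k. rewrite <- (P_add_period (c * IZR m) k). f_equal.
    rewrite plus_IZR, mult_IZR, <- INR_IZR_INZ. unfold c. field. lra. }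
  assert (HDelta : forall y, Delta f (P y) <-> exists m : Z, y = c * IZR m).
  { intros y. split.
    - intros [q [Hq E]]. destruct (Hsing q Hq) as [j [Hj ->]].
      rewrite (proj1 HL), HFn in E by lia. symmetry in E. apply P_eq in E.
      destruct E as [k ->]. exists (g j + k * Z.of_nat n)%Z.
      rewrite plus_IZR, mult_IZR, <- INR_IZR_INZ. unfold c. field. lra.
    - intros [m ->]. destruct (Hc m) as [a [b [Hw [q Hq]]]].
      assert (Ha : nth_error w (length a) = Some sym_s).
      { rewrite Hw, nth_error_app2, Nat.sub_diag by lia. easy. }
      assert (Hj : (length a < N)%nat) by (apply nth_error_Some; now rewrite Ha).
      exists (P (node N (length a))). split; [now apply Hnode|].
      rewrite (proj1 HL), HFn, Hg by lia.
      assert (E : firstn (S (length a)) w = a ++ [sym_s]).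
      { rewrite (firstn_succ_nth w _ sym_p), (nth_error_nth _ _ _ Ha) by easy.
        rewrite Hw, firstn_app, Nat.sub_diag, firstn_all, firstn_O, app_nil_r. easy. }
      rewrite E. replace (height (a ++ [sym_s])) with (m + q * Z.of_nat n)%Z by lia.
      apply HPm. }
  exists f. split; [intros t; exists F; now apply lift_chart|]. split.
  - split; [|split].
    + intros q Hq. destruct (Hsing q Hq) as [j [Hj ->]].
      apply (lift_morse f F _ HL). apply Hnode in Hq; [|easy].
      destruct (Hs j Hq) as [H0 H1]. rewrite EF. split; [easy|].
      change (Derive (Derive F) (node N j) <> 0).
      rewrite (Derive_ext _ (eval u) _ EF).
      now rewrite (is_derive_unique _ _ _ (is_derive_eval u (node N j))).
    + exists (map (fun j => P (node N j)) (seq 0 N)). intros q Hq.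
      destruct (Hsing q Hq) as [j [Hj ->]]. apply in_map_iff. exists j.
      split; [easy|]. apply in_seq. lia.
    + intros q q' Hq Hq' E.
      destruct (Hsing q Hq) as [i [Hi ->]]. destruct (Hsing q' Hq') as [j [Hj ->]].
      apply Hnode in Hq, Hq'; try easy.
      rewrite !(proj1 HL), !HFn, !Hg in E by lia. apply P_eq in E. destruct E as [k E].
      f_equal. f_equal. apply (balanced_residues_distinct w i j Hn Hbal Hq Hq').
      exists k. fold n. apply eq_IZR. rewrite minus_IZR, mult_IZR, <- INR_IZR_INZ.
      apply (Rmult_eq_reg_l c); [|lra]. rewrite Rmult_minus_distr_l, E.
      unfold c. field. lra.
  - exists (map (node N) (seq 0 N)). split; [|split].
    + assert (G : forall m k, StronglySorted Rlt (map (node N) (seq k m))).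
      { induction m as [|m IH]; intros k; [constructor|]. simpl. constructor; [apply IH|].
        apply Forall_forall. intros x Hx. apply in_map_iff in Hx.
        destruct Hx as [i [<- Hi]]. apply in_seq in Hi. apply node_lt; lia. }
      apply G.
    + intros t. unfold A_set. rewrite in_map_iff. split.
      * intros [j [<- Hj]]. apply in_seq in Hj. split; [apply node_bounds; lia|].
        rewrite (proj1 HL). apply HDelta. exists (g j). apply HFn. lia.
      * intros [Hb Hd]. rewrite (proj1 HL) in Hd. apply HDelta in Hd. destruct Hd as [m Hm].
        destruct (node_edge N t HN Hb) as [j [Hj [Hle Hlt]]].
        exists j. split; [|apply in_seq; lia].
        (* Inside an edge [F / c] lies strictly between two consecutive integers. *)
        destruct Hle as [Hlt'|E]; [|easy]. exfalso.
        set (e := turn (firstn (S j) w)) in *.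
        pose proof (derive_sign_increasing F (IZR e) (node N j) t Hex Hlt') as H1.
        pose proof (derive_sign_increasing F (IZR e) t (node N (S j)) Hex Hlt) as H2.
        rewrite HFn, Hm in H1 by lia. rewrite HFn, Hgs, Hm in H2 by lia. fold e in H2.
        assert (H1' : IZR e * (c * IZR (g j)) < IZR e * (c * IZR m)).
        { apply H1. intros s Hs'. rewrite EF. apply Hsgn; [easy|lra]. }
        assert (H2' : IZR e * (c * IZR m) < IZR e * (c * IZR (g j + e))).
        { apply H2. intros s Hs'. rewrite EF. apply Hsgn; [easy|lra]. }
        assert (G1 : (e * g j < e * m)%Z).
        { apply lt_IZR. rewrite !mult_IZR. apply (Rmult_lt_reg_l c); [easy|]. lra. }
        assert (G2 : (e * m < e * (g j + e))%Z).
        { apply lt_IZR. rewrite !mult_IZR. apply (Rmult_lt_reg_l c); [easy|]. lra. }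
        destruct (turn_unit (firstn (S j) w)) as [E|E]; fold e in E; rewrite E in *; lia.
    + rewrite map_map. apply nth_error_ext. intros j.
      rewrite nth_error_map. destruct (Nat.lt_ge_cases j N) as [Hj|Hj].
      * rewrite nth_error_seq. rewrite (proj2 (Nat.ltb_lt j N) Hj). simpl.
        destruct (Hletter j Hj) as [E|E]; rewrite E; f_equal.
        -- symmetry. apply T_singular. now apply Hnode.
        -- unfold T. destruct excluded_middle_informative as [H|H]; [|easy].
           apply Hnode in H; [|easy]. congruence.
      * rewrite (proj2 (nth_error_None w j)) by easy.
        rewrite (proj2 (nth_error_None (seq 0 N) j)) by (now rewrite length_seq). easy.
Qed.

(** * The characterization *)

Lemma count_s_E (w w' : list symbol) : E_equiv w w' -> count_s w = count_s w'.
Proof.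
  intros H. apply E_equiv_rot in H. destruct H as [H|H];
    apply rot_equiv_swap_inv in H; destruct H as [u [v [-> H]]].
  - rewrite H, !count_s_app. apply Nat.add_comm.
  - apply (f_equal count_s) in H. unfold count_s in H at 1.
    rewrite filter_rev, length_rev in H. fold (count_s w') in H.
    rewrite H, !count_s_app. apply Nat.add_comm.
Qed.

Lemma is_Ast_unique (f : circle -> circle) (w w' : list symbol) :
  is_Ast f w -> is_Ast f w' -> w = w'.
Proof.
  intros [l [Hs [Hl ->]]] [l' [Hs' [Hl' ->]]]. f_equal.
  apply sorted_unique; [easy|easy|]. intros t. now rewrite Hl, Hl'.
Qed.

Lemma Ast_sharp_of_word (f : circle -> circle) (A : list nat) :
  A <> [] -> is_Ast f (word A) -> Ast_sharp f = E_class A.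
Proof.
  intros HA Hf. apply functional_extensionality. intros c.
  apply propositional_extensionality. unfold Ast_sharp, E_class. split.
  - intros [w [w' [Hw [Hww' [Hl Hc]]]]].
    rewrite <- (is_Ast_unique f _ _ Hf Hw), (word_gaps w' Hl) in Hww'.
    apply E_equiv_word in Hww'. eapply E_equiv_trans; eauto.
  - intros Hc. exists (word A), (word A). split; [easy|].
    split; [apply E_equiv_refl|]. split; [now apply last_word|].
    now rewrite gaps_word.
Qed.

Lemma Ast_sharp_balanced (f : circle -> circle) (A : list nat) :
  smooth f -> stable f -> A <> [] -> Ast_sharp f A -> balanced (word A).
Proof.
  intros Hsm Hst HA [w [w' [Hw [Hww' [Hl Hc]]]]].
  rewrite (word_gaps w' Hl) in Hww'. apply E_equiv_word in Hc.
  pose proof (E_equiv_trans _ _ _ Hww' Hc) as H.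
  apply (balanced_E w); [easy|]. apply (stable_word_balanced f); try easy.
  rewrite (count_s_E _ _ H), count_s_word. destruct A; [easy|simpl; lia].
Qed.

Theorem theorem2p10 (n : nat) (A : list nat) (hn : (1 <= n)%nat)
    (hA : length A = n) :
  (exists f : circle -> circle,
      smooth f /\ stable f /\ Ast_sharp f = E_class A)
  <-> (exists m : nat, feasible n m A).
Proof.
  subst n. assert (HA : A <> []) by (now intros ->).
  rewrite feasible_balanced by easy. split.
  - intros [f [Hsm [Hst HE]]]. apply (Ast_sharp_balanced f); try easy.
    rewrite HE. apply E_equiv_refl.
  - intros Hb.
    destruct (balanced_word_realized (word A) Hb) as [f [Hsm [Hst Hf]]].
    { now rewrite count_s_word. }
    exists f. split; [easy|]. split; [easy|]. now apply Ast_sharp_of_word.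
Qed.
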